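(* For $i=1,2$, let $G_i$ be a $k_i$-crossing-critical graph with a simple vertex $v_i\in V(G_i)$ of degree $d$. If $d\neq 3$, assume moreover that $v_i$ has a homogeneous neighborhood in $G_i$ for $i=1,2$. Let $k=\max\{\mathrm{cr}(G_1)+k_2,\ \mathrm{cr}(G_2)+k_1\}$ and let $G\in G_1\,{}_{v_1}\!\odot_{v_2}G_2$. If $\mathrm{cr}(G)\ge k$, then $G$ is $k$-crossing-critical.
   Context: Graphs may have multiple edges but no loops (and no vertices of degree two); $\mathrm{cr}$ denotes crossing number. A graph $G$ is $k$-crossing-critical if $\mathrm{cr}(G)\ge k$ and $\mathrm{cr}(G-e)<k$ for every edge $e$. A vertex is simple if it is not incident with multiple edges. For simple vertices $v_i\in V(G_i)$ of equal degree with neighbourhoods $N_i$ and a bijection $\sigma:N_1\to N_2$, the zip product $G_1\odot_\sigma G_2$ is obtained from the disjoint union of $G_1-v_1$ and $G_2-v_2$ by adding the edges $u\sigma(u)$, $u\in N_1$; $G_1\,{}_{v_1}\!\odot_{v_2}G_2$ is the set of all such graphs over all bijections $\sigma$. For $S\subseteq V(G)$, $\Gamma_G(S)$ denotes the pointwise stabilizer of $S$ in $\mathrm{Aut}(G)$; $S$ is $\Gamma$-homogeneous if every permutation of $S$ is the restriction of an automorphism in $\Gamma$; $v$ has a homogeneous neighborhood in $G$ if $N_G(v)$ is $\Gamma_G(\{v\})$-homogeneous. *)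

(* Defs.v *)
From HB Require Import structures.
From mathcomp Require Import all_boot all_order all_algebra all_fingroup.
From mathcomp Require Import all_classical all_reals all_analysis.

Set Implicit Arguments.
Unset Strict Implicit.
Unset Printing Implicit Defensive.

Import Order.TTheory GRing.Theory Num.Theory.
Import numFieldNormedType.Exports.

(* Edges form a type of their own, so that parallel edges are distinct. *)
Record mgraph := MGraph {
  vertex : finType;
  edge : finType;
  ends : edge -> {set vertex};
  card_ends : forall e, #|ends e| = 2 }.

Definition mgraph_iso (G H : mgraph) : Prop :=
  exists (f : vertex G -> vertex H) (g : edge G -> edge H),
    [/\ bijective f, bijective g & forall e, ends (g e) = f @: ends e].

Section LocalNotions.
Variables (G : mgraph) (v : vertex G).

Definition degree : nat := #|[set e : edge G | v \in ends e]|.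

Definition nbhd : {set vertex G} :=
  [set u | [exists e : edge G, ends e == [set u; v]]].

Definition simple_vertex : Prop :=
  forall e e' : edge G, v \in ends e -> ends e = ends e' -> e = e'.

Lemma nbhd_neq (u : vertex G) : u \in nbhd -> u != v.
Proof.
rewrite inE => /existsP[e /eqP Ee]; apply/eqP => uv.
by have := card_ends e; rewrite Ee uv finset.setUid cards1.
Qed.

End LocalNotions.

Definition no_degree_two (G : mgraph) : Prop :=
  forall v : vertex G, degree v <> 2.

Definition del_edge (G : mgraph) (e : edge G) : mgraph :=
  @MGraph (vertex G) {e' : edge G | e' != e} (fun e' => ends (val e'))
    (fun e' => card_ends (val e')).

Section DelVertex.
Variables (G : mgraph) (v : vertex G).

Definition del_vertex_ends (e : {e : edge G | v \notin ends e}) :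
    {set {x : vertex G | x != v}} :=
  [set x | val x \in ends (val e)].

Lemma card_del_vertex_ends e : #|del_vertex_ends e| = 2.
Proof.
rewrite -(card_ends (val e)) -(card_imset _ val_inj); apply: eq_card => x.
apply/imsetP/idP => [[y + ->]|xe]; first by rewrite inE.
have xv : x != v by apply: (memPn (valP e)).
by exists (Sub x xv); rewrite ?inE.
Qed.

Definition del_vertex : mgraph := MGraph card_del_vertex_ends.

Definition nbr_del (u : {u | u \in nbhd v}) : vertex del_vertex :=
  Sub (val u) (nbhd_neq (valP u)).

End DelVertex.

Section ZipProduct.
Variables (G1 G2 : mgraph) (v1 : vertex G1) (v2 : vertex G2).
Variable sigma : {u | u \in nbhd v1} -> {w | w \in nbhd v2}.

Local Notation H1 := (del_vertex v1).
Local Notation H2 := (del_vertex v2).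

Definition zip_ends (x : edge H1 + edge H2 + {u | u \in nbhd v1}) :
    {set vertex H1 + vertex H2} :=
  match x with
  | inl (inl e) => inl @: ends e
  | inl (inr e) => inr @: ends e
  | inr u => [set inl (nbr_del u); inr (nbr_del (sigma u))]
  end.

Lemma card_zip_ends x : #|zip_ends x| = 2.
Proof.
case: x => [[e|e]|u] /=; last by rewrite cards2.
- by rewrite card_imset ?card_del_vertex_ends // => ? ? [].
- by rewrite card_imset ?card_del_vertex_ends // => ? ? [].
Qed.

Definition zip_product : mgraph := MGraph card_zip_ends.

End ZipProduct.

(* The disjoint union, hence the zip product, is only determined up to
   isomorphism. *)
Definition in_zip_products (G1 G2 : mgraph) (v1 : vertex G1) (v2 : vertex G2)
    (G : mgraph) : Prop :=
  exists2 sigma : {u | u \in nbhd v1} -> {w | w \in nbhd v2},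
    bijective sigma & mgraph_iso G (zip_product sigma).

(* Automorphisms are identified with their action on vertices; the permutation
   q of the edges expresses that edge multiplicities are preserved. *)
Definition mg_aut (G : mgraph) : {set {perm vertex G}} :=
  [set p : {perm vertex G} | [exists q : {perm edge G},
     [forall e, ends (q e) == [set p x | x in ends e]]]].

Definition pt_stab (G : mgraph) (S : {set vertex G}) : {set {perm vertex G}} :=
  'C_(mg_aut G)(S | 'P)%g.

(* perm_on S s: the permutations of S are given by their extensions to all
   vertices by the identity. *)
Definition homogeneous (G : mgraph) (Gamma : {set {perm vertex G}})
    (S : {set vertex G}) : Prop :=
  forall s : {perm vertex G}, perm_on S s ->
    exists2 p : {perm vertex G}, p \in Gamma & {in S, p =1 s}.

Definition homogeneous_nbhd (G : mgraph) (v : vertex G) : Prop :=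
  homogeneous (pt_stab [set v]) (nbhd v).

Section CrossingNumber.
Local Open Scope ring_scope.
Local Open Scope classical_set_scope.
Variables (R : realType) (G : mgraph).

Definition edge_interior (arc : edge G -> R -> R * R) (e : edge G) :
    set (R * R) := arc e @` `]0, 1[.

(* Drawings in the plane R * R: edges are simple arcs, parametrized by [0, 1]
   in either direction. *)
Record is_drawing (pt : vertex G -> R * R) (arc : edge G -> R -> R * R) :
    Prop := IsDrawing {
  drawing_pt_inj : injective pt;
  drawing_arc_continuous : forall e, {within `[0, 1], continuous (arc e)};
  drawing_arc_inj : forall e, {in `[0, 1] &, injective (arc e)};
  drawing_arc_ends : forall e, exists u w,
    [/\ ends e = [set u; w]%SET, arc e 0 = pt u & arc e 1 = pt w];
  drawing_avoids_vertices : forall e v, ~ edge_interior arc e (pt v);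
  drawing_no_triple : forall (e1 e2 e3 : edge G) (p : R * R),
    e1 != e2 -> e1 != e3 -> e2 != e3 ->
    ~ (edge_interior arc e1 p /\ edge_interior arc e2 p /\
       edge_interior arc e3 p) }.

(* Every common interior point of two edges is a crossing; in particular a
   point where two edges merely touch is counted. *)
Definition crossings (arc : edge G -> R -> R * R) : set (R * R) :=
  [set p | exists e e' : edge G,
     [/\ e != e', edge_interior arc e p & edge_interior arc e' p]].

Definition drawable_with (n : nat) : Prop :=
  exists (pt : vertex G -> R * R) (arc : edge G -> R -> R * R),
    is_drawing pt arc /\ (crossings arc #= `I_n)%card.

(* The least number of crossings of a drawing; the default value of xget is
   irrelevant since every graph has a drawing with finitely many crossings. *)
Definition crossing_number : nat :=
  xget 0%N [set n | drawable_with n /\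
                    forall m, drawable_with m -> (n <= m)%N].

End CrossingNumber.

Definition crossing_critical (R : realType) (k : nat) (G : mgraph) : Prop :=
  (k <= crossing_number R G)%N /\
  forall e : edge G, (crossing_number R (del_edge e) < k)%N.

(* Main.v *)
Require Import Defs.
From mathcomp Require Import all_boot all_order all_algebra all_fingroup.
From mathcomp Require Import all_classical all_reals all_analysis.
From mathcomp Require Import ring lra.

(* Delete e from G and suppose e is not an edge of G2 - v2 (the other case is
   symmetric).  Take an optimal drawing of G1 - e1, where e1 is e itself or the
   edge at v1 from which e arose, and an optimal drawing of G2.  In a drawing, cut
   all edges at v at their first entry into a small disc around v; an inversion
   centred at a free point of the bounding circle turns the exterior of the disc
   into a half-plane, in which the edges at v end at distinct points of the
   boundary line.  After reflecting one of the two half-plane drawings, they fit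
   together to a drawing of G - e with at most cr(G1 - e1) + cr(G2) crossings, as
   soon as the ends of corresponding edges coincide.  Monotone maps of the line
   make the positions of the ends arbitrary, so only their order matters, and
   that of G2 can be prescribed: by an automorphism if the neighbourhood of v2 is
   homogeneous, and by further inversions centred on the line if v2 has degree 3.
   No regularity of the arcs beyond continuity is used. *)

Set Implicit Arguments.
Unset Strict Implicit.
Unset Printing Implicit Defensive.

Import Order.TTheory GRing.Theory Num.Theory.
Import numFieldNormedType.Exports.

Local Open Scope ring_scope.
Local Open Scope classical_set_scope.

(** * Drawings as systems of curves *)

(** Counterpart of [edge_interior] for curves indexed by an arbitrary type, so that it also serves
    drawings with a blown-up vertex. *)
Definition inner (R : realType) (E : Type) (arc : E -> R -> R * R) (e : E)
  (p : R * R) : Prop := exists2 t, 0 < t < 1 & arc e t = p.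

(* [s] is a list containing all crossings, so [size s] bounds their number. *)
Record curve_system (R : realType) (V E : Type) (pt : V -> R * R)
    (arc : E -> R -> R * R) (s : seq (R * R)) : Prop := CurveSystem {
  cs_pt_inj : injective pt;
  cs_cont : forall e, {within `[0, 1], continuous (arc e)};
  cs_inj : forall e t t', 0 <= t <= 1 -> 0 <= t' <= 1 ->
    arc e t = arc e t' -> t = t';
  cs_avoid : forall e v, ~ inner arc e (pt v);
  cs_no_triple : forall e1 e2 e3 p, e1 <> e2 -> e1 <> e3 -> e2 <> e3 ->
    inner arc e1 p -> inner arc e2 p -> inner arc e3 p -> False;
  cs_cross : forall e e' p, e <> e' -> inner arc e p -> inner arc e' p ->
    p \in s }.

Lemma edge_interiorP (R : realType) (G : mgraph) (arc : edge G -> R -> R * R)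
  (e : edge G) (p : R * R) : edge_interior arc e p <-> inner arc e p.
Proof.
split=> [[t /=]|[t t01 <-]]; first by rewrite in_itv /= => t01 <-; exists t.
by exists t => //=; rewrite in_itv.
Qed.

Definition joins (R : realType) (V E : finType) (en : E -> {set V})
    (pt : V -> R * R) (arc : E -> R -> R * R) (e : E) : Prop :=
  exists u w, [/\ en e = [set u; w]%SET, arc e 0 = pt u & arc e 1 = pt w].

(** The crossings form a subset of the finite set [s], so they have an exact number, bounded by
    [size s]. *)
Lemma curve_system_drawable (R : realType) (G : mgraph) pt
    (arc : edge G -> R -> R * R) s :
  curve_system pt arc s -> (forall e, joins (@ends G) pt arc e) ->
  exists2 n, drawable_with R G n & (n <= size s)%N.
Proof.
move=> cs ja.
have sub : crossings arc `<=` [set` s].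
  move=> p [e [e' [/eqP ee' /edge_interiorP ep /edge_interiorP e'p]]].
  exact: cs_cross cs _ _ _ ee' ep e'p.
have fin : finite_set (crossings arc).
  by apply: sub_finite_set sub _; exact: finite_seq.
have [n nE] := fin.
exists n.
  exists pt, arc; split => //; split.
  - exact: cs_pt_inj cs.
  - exact: cs_cont cs.
  - move=> e t t'; rewrite !inE /= !in_itv /= => t01 t'01.
    exact: cs_inj cs _ _ _ t01 t'01.
  - exact: ja.
  - move=> e v /edge_interiorP; exact: cs_avoid cs _ _.
  - move=> e1 e2 e3 p /eqP n12 /eqP n13 /eqP n23.
    move=> [/edge_interiorP i1 [/edge_interiorP i2 /edge_interiorP i3]].
    exact: (cs_no_triple cs n12 n13 n23 i1 i2 i3).
have sI : [set` s] = nth 0 s @` `I_(size s).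
  apply/seteqP; split=> [p /= /(nthP 0)[i si <-]|p [i /= si <-]]; first by exists i.
  exact: mem_nth.
rewrite -card_le_II.
have /card_eqPle[_ h1] := nE; apply: card_le_trans h1 _.
apply: card_le_trans (subset_card_le sub) _; rewrite sI.
exact: card_image_le.
Qed.

Lemma drawable_curve_system (R : realType) (G : mgraph) n :
  drawable_with R G n -> exists pt (arc : edge G -> R -> R * R) s,
  [/\ curve_system pt arc s, (forall e, joins (@ends G) pt arc e)
    & (size s <= n)%N].
Proof.
move=> [pt [arc [[d1 d2 d3 d4 d5 d6] cn]]].
have [s [ss sP]] : exists s : seq (R * R), (size s <= n)%N /\
    forall p, crossings arc p -> p \in s.
  have [f [_ _ fs]] : exists f, set_bij `I_n (crossings arc) f.
    exact: (elimT card_set_bijP (card_esym cn)).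
  exists [seq f i | i <- iota 0 n]; rewrite size_map size_iota; split => // p.
  by case/fs => i /= ilt <-; apply: map_f; rewrite mem_iota.
exists pt, arc, s; split => //; split => //.
- move=> e t t' t01 t'01 h; apply: (d3 e) => //; by rewrite inE /= in_itv.
- move=> e1 e2 e3 p /eqP n12 /eqP n13 /eqP n23 i1 i2 i3.
  by apply: (d6 e1 e2 e3 p n12 n13 n23); split; [|split]; apply/edge_interiorP.
- move=> e e' p /eqP ee' i i'; apply: sP; exists e, e'.
  by split => //; apply/edge_interiorP.
Qed.

Lemma crossing_number_le (R : realType) (G : mgraph) n :
  drawable_with R G n -> (crossing_number R G <= n)%N.
Proof.
move=> dn; rewrite /crossing_number.
(* Without a least element the value is the default [0], and the bound is trivial. *)
case: xgetP => [m -> [_ +]|_]; last by [].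
exact.
Qed.

Lemma crossing_number_drawable (R : realType) (G : mgraph) n :
  drawable_with R G n -> drawable_with R G (crossing_number R G).
Proof.
move=> dn; rewrite /crossing_number.
case: xgetP => [m -> [] //|none].
pose P k := `[< drawable_with R G k >].
have exP : exists k, P k by exists n; apply/asboolP.
case: (ex_minnP exP) => m /asboolP dm mmin.
case: (none m); split => // k dk; apply: mmin; exact/asboolP.
Qed.

(** Continuity of [F] is asked only along the curve, because inversions are singular at their
    centre. *)
Lemma within_comp (R : realType) (f : R -> R * R) (F : R * R -> R * R)
    (A : set R) :
  {within A, continuous f} -> (forall t, A t -> {for f t, continuous F}) ->
  {within A, continuous (F \o f)}.
Proof.
move=> /subspace_continuousP cf cF; apply/subspace_continuousP => t At.
exact: cvg_comp (cf t At) (cF t At).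
Qed.

(** * Drawings with a blown-up vertex *)

(* A drawing in which the vertex [v] is blown up: the curves of the edges at [v]
   end at distinct points [b e] outside the open region [U], in which everything
   else lies. *)
Record open_system (R : realType) (V E : finType) (en : E -> {set V}) (v : V)
    (U : set (R * R)) (b : E -> R * R) (pt : {u | u != v} -> R * R)
    (arc : E -> R -> R * R) (s : seq (R * R)) : Prop := OpenSystem {
  os_cs : curve_system pt arc s;
  os_pt : forall u, U (pt u);
  os_arc : forall e t, 0 <= t < 1 -> U (arc e t);
  os_far : forall e, v \notin en e -> exists u w : {u | u != v},
    [/\ en e = [set val u; val w]%SET, arc e 0 = pt u & arc e 1 = pt w];
  os_near : forall e, v \in en e -> exists u : {u | u != v},
    [/\ en e = [set val u; v]%SET, arc e 0 = pt u & arc e 1 = b e];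
  os_inj : {in [pred e | v \in en e] &, injective b} }.

Lemma os_end (R : realType) (V E : finType) (en : E -> {set V}) (v : V)
    (U : set (R * R)) (b : E -> R * R) (pt : {u | u != v} -> R * R)
    (arc : E -> R -> R * R) (s : seq (R * R)) e t :
  open_system en U b pt arc s -> 0 <= t <= 1 ->
  U (arc e t) \/ v \in en e /\ arc e t = b e.
Proof.
move=> os /andP[t0]; rewrite le_eqVlt => /orP[/eqP ->|t1]; last first.
  by left; apply: os_arc os _ _ _; rewrite t0.
have [ve|ve] := boolP (v \in en e).
  by right; have [u []] := os_near os ve.
by left; have [u [w [_ _ ->]]] := os_far os ve; exact: os_pt os _.
Qed.

(** The set [S] contains every point of every curve, ends included; hence a map that is injective
    and continuous on [S] carries crossings to crossings and creates none. *)
Lemma open_system_map (R : realType) (V E : finType) (en : E -> {set V})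
    (v : V) (U U' : set (R * R)) (b b' : E -> R * R)
    (pt : {u | u != v} -> R * R) (arc : E -> R -> R * R) (s : seq (R * R))
    (F : R * R -> R * R) :
  let S := [set p | U p \/ exists2 e, v \in en e & p = b e] in
  {in S &, injective F} -> (forall p, S p -> {for p, continuous F}) ->
  (forall p, U p -> U' (F p)) -> (forall e, v \in en e -> F (b e) = b' e) ->
  open_system en U b pt arc s ->
  open_system en U' b' (F \o pt) (fun e => F \o arc e) (map F s).
Proof.
move=> S Finj Fcont FU Fb os.
have Sarc e t : 0 <= t <= 1 -> S (arc e t).
  by move=> /(os_end e os)[|[ve ->]]; [left|right; exists e].
have Spt u : S (pt u) by left; exact: os_pt os _.
have Finj' p q : S p -> S q -> F p = F q -> p = q.
  by move=> Sp Sq; apply: Finj; rewrite inE.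
have Sinner e p : inner arc e p -> S p.
  move=> [t /andP[t0 t1] <-]; apply: Sarc; by rewrite !ltW.
have innerF e p : inner (fun e => F \o arc e) e p ->
    exists2 q, inner arc e q & p = F q.
  by move=> [t t01 <-]; exists (arc e t) => //; exists t.
split.
- split.
  + move=> u w /Finj' h; apply: (cs_pt_inj (os_cs os)); exact: h.
  + move=> e; apply: within_comp; first exact: cs_cont (os_cs os) _.
    move=> t /=; rewrite in_itv /= => t01; exact/Fcont/Sarc.
  + move=> e t t' t01 t'01 /Finj' h.
    by apply: (cs_inj (os_cs os) t01 t'01); apply: h; exact: Sarc.
  + move=> e u /innerF[q qe /Finj' h].
    have qE : pt u = q by apply: h => //; exact: Sinner qe.
    by apply: (cs_avoid (os_cs os) (e := e) (v := u)); rewrite qE.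
  + move=> e1 e2 e3 p n12 n13 n23 /innerF[q1 i1 ->].
    move=> /innerF[q2 i2 /Finj' h2] /innerF[q3 i3 /Finj' h3].
    have q12 : q1 = q2 by apply: h2; [exact: Sinner i1|exact: Sinner i2].
    have q13 : q1 = q3 by apply: h3; [exact: Sinner i1|exact: Sinner i3].
    rewrite -q12 in i2; rewrite -q13 in i3.
    exact: (cs_no_triple (os_cs os) n12 n13 n23 i1 i2 i3).
  + move=> e e' p ee' /innerF[q1 i1 ->] /innerF[q2 i2 /Finj' h2].
    have q12 : q1 = q2 by apply: h2; [exact: Sinner i1|exact: Sinner i2].
    rewrite -q12 in i2; apply: map_f; exact: (cs_cross (os_cs os) ee' i1 i2).
- by move=> u; apply: FU; exact: os_pt os _.
- by move=> e t t01; apply: FU; exact: os_arc os _ _ t01.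
- move=> e ve; have [u [w [ee e0 e1]]] := os_far os ve.
  by exists u, w; rewrite /= e0 e1.
- move=> e ve; have [u [ee e0 e1]] := os_near os ve.
  by exists u; rewrite /= e0 e1 Fb.
- move=> e e'; rewrite !inE => ve ve'; rewrite -!Fb // => /Finj' h.
  by apply: (os_inj os) => //; apply: h; right; [exists e|exists e'].
Qed.

(* Blown-up drawings in the lower half-plane; [x e] is the position on the
   horizontal axis at which the edge [e] at [v] ends. *)
Definition halfplane (R : realType) (V E : finType) (en : E -> {set V}) (v : V)
    (n : nat) (x : E -> R) : Prop :=
  exists pt arc s, open_system en (v := v) [set p : R * R | p.2 < 0]
    (fun e => (x e, 0)) pt arc s /\ (size s <= n)%N.

Lemma halfplane_map (R : realType) (V E : finType) (en : E -> {set V}) (v : V)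
    (n : nat) (x x' : E -> R) (F : R * R -> R * R) :
  let S := [set p : R * R | p.2 < 0 \/ exists2 e, v \in en e & p = (x e, 0)] in
  (forall p q, S p -> S q -> F p = F q -> p = q) ->
  (forall p, S p -> {for p, continuous F}) ->
  (forall p, p.2 < 0 -> (F p).2 < 0) ->
  (forall e, v \in en e -> F (x e, 0) = (x' e, 0)) ->
  halfplane en v n x -> halfplane en v n x'.
Proof.
move=> S Finj Fcont FU Fb [pt [arc [s [os sn]]]].
exists (F \o pt), (fun e => F \o arc e), (map F s); rewrite size_map; split => //.
apply: open_system_map os => // p q; rewrite !inE; exact: Finj.
Qed.

(** * Inversions *)

(* Inversion at [t] followed by the similarity turning [n] into the vertical
   direction; it is [(0, 0)] at [p = t]. *)
Definition inversion (R : realType) (t n p : R * R) : R * R :=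
  let d := (p.1 - t.1) ^+ 2 + (p.2 - t.2) ^+ 2 in
  (((p.1 - t.1) * n.2 - (p.2 - t.2) * n.1) / d,
   ((p.1 - t.1) * n.1 + (p.2 - t.2) * n.2) / d).

Lemma sqr_sum_gt0 (R : realType) (p t : R * R) :
  p <> t -> 0 < (p.1 - t.1) ^+ 2 + (p.2 - t.2) ^+ 2.
Proof.
move=> pt; rewrite lt_def addr_ge0 ?sqr_ge0 // andbT.
apply/eqP => /eqP; rewrite paddr_eq0 ?sqr_ge0 // !sqrf_eq0 !subr_eq0.
by case: p t pt => [a b] [c d] /= pt /andP[/eqP ac /eqP bd]; apply: pt; rewrite ac bd.
Qed.

(** Since [n] is nonzero, the similarity can be undone, which recovers the vector
    [(p - t) / |p - t|^2]. Its squared length is [1 / |p - t|^2], so the distance to [t] is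
    determined, and then [p] itself. *)
Lemma inversion_inj (R : realType) (t n p q : R * R) :
  n <> 0 -> p <> t -> q <> t -> inversion t n p = inversion t n q -> p = q.
Proof.
move=> n0 pt qt; have := sqr_sum_gt0 pt; have := sqr_sum_gt0 qt.
have := sqr_sum_gt0 n0; case: n {n0} => n1 n2 /=; rewrite !subr0.
rewrite /inversion; case: p pt => p1 p2 _; case: q qt => q1 q2 _; case: t => t1 t2 /=.
set a := p1 - t1; set b := p2 - t2; set c := q1 - t1; set d := q2 - t2.
set P := a ^+ 2 + b ^+ 2; set Q := c ^+ 2 + d ^+ 2; set N := n1 ^+ 2 + n2 ^+ 2.
move=> N0 Q0 P0 [h1 h2].
have eqa : a / P = c / Q.
  have : N * (a / P) = N * (c / Q).
    have -> : N * (a / P) = n2 * ((a * n2 - b * n1) / P) + n1 * ((a * n1 + b * n2) / P).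
      by rewrite /N; ring.
    by rewrite h1 h2 /N; ring.
  by move/(mulfI (lt0r_neq0 N0)).
have eqb : b / P = d / Q.
  have : N * (b / P) = N * (d / Q).
    have -> : N * (b / P) = n2 * ((a * n1 + b * n2) / P) - n1 * ((a * n2 - b * n1) / P).
      by rewrite /N; ring.
    by rewrite h1 h2 /N; ring.
  by move/(mulfI (lt0r_neq0 N0)).
have PQ : P = Q.
  have : (a / P) ^+ 2 + (b / P) ^+ 2 = (c / Q) ^+ 2 + (d / Q) ^+ 2 by rewrite eqa eqb.
  have -> : (a / P) ^+ 2 + (b / P) ^+ 2 = P^-1.
    by rewrite !expr_div_n -mulrDl -/P expr2 invfM mulrA divff ?mul1r ?lt0r_neq0.
  have -> : (c / Q) ^+ 2 + (d / Q) ^+ 2 = Q^-1.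
    by rewrite !expr_div_n -mulrDl -/Q expr2 invfM mulrA divff ?mul1r ?lt0r_neq0.
  by move/invr_inj.
move: eqa eqb; rewrite PQ => /(mulIf (invr_neq0 (lt0r_neq0 Q0))) ac.
move=> /(mulIf (invr_neq0 (lt0r_neq0 Q0))) bd.
by rewrite -(subrK t1 p1) -(subrK t2 p2) -/a -/b ac bd /c /d !subrK.
Qed.

Lemma inversion_cont (R : realType) (t n p : R * R) :
  p <> t -> {for p, continuous (inversion t n)}.
Proof.
move=> pt; have d0 := lt0r_neq0 (sqr_sum_gt0 pt).
have c1 : (fun q : R * R => q.1 - t.1) q @[q --> p] --> p.1 - t.1.
  by apply: cvgB; [exact: cvg_fst|exact: cvg_cst].
have c2 : (fun q : R * R => q.2 - t.2) q @[q --> p] --> p.2 - t.2.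
  by apply: cvgB; [exact: cvg_snd|exact: cvg_cst].
have cd : (fun q : R * R => ((q.1 - t.1) ^+ 2 + (q.2 - t.2) ^+ 2)^-1) q @[q --> p]
    --> ((p.1 - t.1) ^+ 2 + (p.2 - t.2) ^+ 2)^-1.
  apply: cvgV => //; rewrite !expr2.
  by apply: cvgD; apply: cvgM.
have k1 : (fun q : R * R => n.1) q @[q --> p] --> n.1 by exact: cvg_cst.
have k2 : (fun q : R * R => n.2) q @[q --> p] --> n.2 by exact: cvg_cst.
exact: cvg_pair (cvgM (cvgB (cvgM c1 k2) (cvgM c2 k1)) cd)
                (cvgM (cvgD (cvgM c1 k1) (cvgM c2 k2)) cd).
Qed.

(** * Reparametrization and first entry into a disc *)

(** Composition with a map into [[0, 1]] trades continuity within the segment for continuity on the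
    whole line. *)
Lemma within_reparam (R : realType) (T : topologicalType) (f : R -> T)
    (h : R -> R) :
  {within `[0, 1], continuous f} -> continuous h ->
  (forall t, 0 <= h t <= 1) -> continuous (f \o h).
Proof.
move=> /subspace_continuousP cf ch h01 t.
have /cf : `[0, 1] (h t) by rewrite /= in_itv /= h01.
move=> cft; apply: cvg_comp cft => P /= wP.
have : \forall y \near t, `[0, 1] (h y) -> P (h y) by exact: ch t _ wP.
by apply: filterS => y; apply; rewrite /= in_itv; exact: h01.
Qed.

(** Retraction of the line onto [[0, 1]]; composing with it extends an arc continuously to the whole
    line. *)
Definition clamp (R : realType) (t : R) : R := Num.min (Num.max t 0) 1.

Lemma clamp01 (R : realType) (t : R) : 0 <= clamp t <= 1.
Proof. by rewrite /clamp ge_min lexx orbT andbT le_min ler01 le_max lexx orbT. Qed.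

Lemma clampE (R : realType) (t : R) : 0 <= t <= 1 -> clamp t = t.
Proof.
by move=> /andP[t0 t1]; rewrite /clamp (max_idPl t0) (min_idPl t1).
Qed.

Lemma clamp_cont (R : realType) : continuous (@clamp R).
Proof.
move=> t.
have cmax : {for t, continuous (fun t : R => Num.max t 0 : R^o)}.
  exact: (@continuous_max R R id (fun=> 0) t (@cvg_id _ _) (@cvg_cst _ _ _ _ _)).
exact: (@continuous_min R R _ (fun=> 1) t cmax (@cvg_cst _ _ _ _ _)).
Qed.

Lemma within_affine (R : realType) (T : topologicalType) (f : R -> T) (a b : R) :
  {within `[0, 1], continuous f} -> 0 <= a <= 1 -> 0 <= a + b <= 1 ->
  {within `[0, 1], continuous (fun t => f (a + b * t))}.
Proof.
move=> cf a01 ab01.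
have h01 t : 0 <= t <= 1 -> 0 <= a + b * t <= 1.
  by move=> ?; apply/andP; split; nra.
pose g := f \o (fun t => a + b * clamp t).
have cg : continuous g.
  apply: within_reparam => // t; last exact/h01/clamp01.
  apply: cvgD; first exact: cvg_cst.
  by apply: cvgM; [exact: cvg_cst|exact: clamp_cont].
apply: (@subspace_eq_continuous _ _ _ g); last exact: continuous_subspaceT.
by move=> t; rewrite inE /= in_itv /= => t01; rewrite /g /= clampE.
Qed.

(** The times at which [f] is at most [r] form a nonempty compact set, and [t0] is its minimum. *)
Lemma first_entry (R : realType) (f : R -> R) (r : R) :
  {within `[0, 1], continuous f} -> r < f 0 -> f 1 < r ->
  exists t0, [/\ 0 < t0 < 1, f t0 = r & forall t, 0 <= t < t0 -> r < f t].
Proof.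
move=> cf f0 f1.
pose g := f \o @clamp R.
have cg : continuous g by apply: within_reparam => //; [exact: clamp_cont|exact: clamp01].
pose A := `[0, 1] `&` g @^-1` [set y | y <= r].
have gE t : 0 <= t <= 1 -> g t = f t by move=> t01; rewrite /g /= clampE.
have cA : compact A.
  apply: compact_closedI; first exact: segment_compact.
  apply: preimage_closed; last exact: closed_le.
  by move=> t _; exact: cg.
have [] := @compact_EVT_min _ _ id A _ cA.
- exists 1; split; first by rewrite /= in_itv /= ler01 lexx.
  by rewrite /= gE ?ler01 ?lexx // ltW.
- by apply: continuous_subspaceT => t; exact: cvg_id.
move=> t0; rewrite inE => -[] /= t01 gt0 tmin; rewrite in_itv /= in t01.
have below t : 0 <= t < t0 -> r < f t.
  move=> /andP[t_ge0 tt0]; rewrite ltNge; apply/negP => ft.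
  have t1 : 0 <= t <= 1.
    by rewrite t_ge0 (le_trans (ltW tt0)) //; case/andP: t01.
  have tA : A t.
    by split; [rewrite /= in_itv /= t1|rewrite /= gE].
  by have := tmin t (mem_set tA); rewrite leNgt tt0.
have t0r : f t0 = r.
  rewrite gE // in gt0; apply/eqP; rewrite eq_le gt0 /= leNgt; apply/negP => ft0.
  (* If [f t0 < r], the intermediate value theorem gives an earlier time with value [r], against the
     minimality of [t0]. *)
  have ct : {within `[0, t0], continuous g} by exact: continuous_subspaceT.
  have t0_ge0 : 0 <= t0 by case/andP: t01.
  have [] := @IVT _ g 0 t0 r t0_ge0 ct.
    rewrite !gE ?lexx ?ler01 // ge_min le_max.
    by rewrite (ltW ft0) orbT (ltW f0).
  move=> c; rewrite in_itv /= => /andP[c0 ct0].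
  rewrite gE ?c0 ?(le_trans ct0) //; last by case/andP: t01.
  move=> fc; move: ct0; rewrite le_eqVlt => /orP[/eqP cE|ct0].
    by move: ft0; rewrite -cE fc ltxx.
  by have := below c; rewrite c0 ct0 fc ltxx => /(_ isT).
exists t0; split => //; case/andP: t01; rewrite le_eqVlt => /orP[/eqP t00|->].
  by move: f0; rewrite t00 t0r ltxx.
rewrite le_eqVlt => /orP[/eqP t10|-> //].
by move: f1; rewrite -t10 t0r ltxx.
Qed.

(** * Cutting a drawing around a vertex *)

Definition sqdist (R : realType) (p c : R * R) : R :=
  (p.1 - c.1) ^+ 2 + (p.2 - c.2) ^+ 2.

Lemma small_pos (R : realType) (T : finType) (f : T -> R) :
  (forall i, 0 < f i) -> exists2 r, 0 < r & forall i, r < f i.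
Proof.
move=> f0; near (0 : R)^'+ => r; exists r; first by near: r; exact: nbhs_right_gt.
near: r; apply: (@filter_forall _ T (fun i r => r < f i)) => i.
exact: nbhs_right_lt.
Unshelve. all: by end_near. Qed.

Lemma within_sqdist (R : realType) (f : R -> R * R) (c : R * R) (A : set R) :
  {within A, continuous f} -> {within A, continuous (fun t => sqdist (f t) c)}.
Proof.
move=> /subspace_continuousP cf; apply/subspace_continuousP => t At.
have c1 : (fun t => (f t).1 - c.1) x @[x --> within A (nbhs t)] --> (f t).1 - c.1.
  by apply: cvgB; [exact: cvg_comp (cf t At) cvg_fst|exact: cvg_cst].
have c2 : (fun t => (f t).2 - c.2) x @[x --> within A (nbhs t)] --> (f t).2 - c.2.
  by apply: cvgB; [exact: cvg_comp (cf t At) cvg_snd|exact: cvg_cst].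
exact: cvgD (cvgM c1 c1) (cvgM c2 c2).
Qed.

Lemma affine_open (R : realType) (a b t : R) : b <> 0 -> 0 <= a <= 1 ->
  0 <= a + b <= 1 -> 0 < t < 1 -> 0 < a + b * t < 1.
Proof.
move=> /eqP b0 a01 ab01 t01; have [bn|bp|b00] := ltgtP b 0; last first.
- by rewrite b00 eqxx in b0.
- by apply/andP; split; nra.
- by apply/andP; split; nra.
Qed.

(** Only finitely many positive bounds have to be met: one for each other vertex, each listed
    crossing and each edge avoiding [v]. The number [r] is a squared radius. *)
Lemma separating_radius (R : realType) (G : mgraph) (v : vertex G)
    (pt : vertex G -> R * R) (arc : edge G -> R -> R * R) (s : seq (R * R)) :
  curve_system pt arc s -> (forall e, joins (@ends G) pt arc e) ->
  exists r, [/\ 0 < r, forall u, u != v -> r < sqdist (pt u) (pt v),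
    forall p, p \in s -> p <> pt v -> r < sqdist p (pt v) &
    forall e t, v \notin ends e -> 0 <= t <= 1 -> r < sqdist (arc e t) (pt v)].
Proof.
move=> cs ja.
(* The arc of an edge that avoids [v] misses [pt v], so its squared distance attains a positive
   minimum; edges at [v] get the dummy bound [1]. *)
have away e : exists m, 0 < m /\ (v \notin ends e -> forall t, 0 <= t <= 1 ->
    m <= sqdist (arc e t) (pt v)).
  have [ve|ve] := boolP (v \in ends e); first by exists 1.
  have [t0] := EVT_min ler01 (within_sqdist (c := pt v) (cs_cont cs (e := e))).
  rewrite in_itv /= => t01 tmin; exists (sqdist (arc e t0) (pt v)); split.
    apply: sqr_sum_gt0 => a0; case/andP: t01.
    have [u [w [ee e0 e1]]] := ja e.
    rewrite le_eqVlt => /orP[/eqP t00|tp].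
      have uv : v = u by apply: (cs_pt_inj cs); rewrite -a0 -t00.
      by move: ve; rewrite ee uv !inE eqxx.
    rewrite le_eqVlt => /orP[/eqP t00|tl].
      have uv : v = w by apply: (cs_pt_inj cs); rewrite -a0 t00.
      by move: ve; rewrite ee uv !inE eqxx orbT.
    by apply: (cs_avoid cs (e := e) (v := v)); exists t0; rewrite ?tp.
  by move=> _ t t01'; apply: tmin; rewrite in_itv.
have [m mP] := choice away.
pose f (i : vertex G + 'I_(size s) + edge G) := match i with
  | inl (inl u) => if u == v then 1 else sqdist (pt u) (pt v)
  | inl (inr i) => if s`_i == pt v then 1 else sqdist s`_i (pt v)
  | inr e => m e end.
have [[[u|i]|e]|r r0 rf] := @small_pos R _ f.
- by rewrite /f; case: eqP => // uv; apply: sqr_sum_gt0 => /(cs_pt_inj cs).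
- by rewrite /f; case: eqP => // uv; exact: sqr_sum_gt0.
- by have [] := mP e.
exists r; split => //.
- by move=> u /negPf uv; have := rf (inl (inl u)); rewrite /f uv.
- move=> p /(nthP 0)[i si <-] /eqP/negPf pv.
  by have := rf (inl (inr (Ordinal si))); rewrite /f /= pv.
- move=> e t ve t01; apply: lt_le_trans (rf (inr e)) _.
  by have [_] := mP e; apply.
Qed.

(** Each edge at [v] is run from its other end and stopped at its first entry into the disc of
    squared radius [r]; all other edges stay as they are. Pieces of old arcs have no new crossings,
    so [s] is kept. *)
Lemma drawing_cut (R : realType) (G : mgraph) (v : vertex G)
    (pt : vertex G -> R * R) (arc : edge G -> R -> R * R) (s : seq (R * R)) :
  curve_system pt arc s -> (forall e, joins (@ends G) pt arc e) ->
  exists r b arc', [/\ 0 < r, forall e, v \in ends e -> sqdist (b e) (pt v) = r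
    & open_system (@ends G) (v := v) [set p | r < sqdist p (pt v)] b
        (pt \o val) arc' s].
Proof.
move=> cs ja; have [r [r0 rpt rs rarc]] := separating_radius v cs ja.
have vv : sqdist (pt v) (pt v) = 0 by rewrite /sqdist !subrr expr0n addr0.
(* The parameters of the far end and of [v] are [a] and [a + b]; the shorter step [c] leads from [a]
   to the entry time. *)
have entry e a b u : ends e = [set u; v]%SET -> u != v ->
    0 <= a <= 1 -> 0 <= a + b <= 1 -> b <> 0 -> arc e a = pt u ->
    arc e (a + b) = pt v -> exists c : R,
    [/\ c <> 0, 0 < a + c < 1, sqdist (arc e (a + c)) (pt v) = r &
      forall t, 0 <= t < 1 -> r < sqdist (arc e (a + c * t)) (pt v)].
  move=> ee uv a01 ab01 b0 ea eb.
  have [] := @first_entry _ (fun t => sqdist (arc e (a + b * t)) (pt v)) r.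
  - apply: within_sqdist; apply: within_affine => //; exact: (cs_cont cs (e := e)).
  - by rewrite mulr0 addr0 ea; exact: rpt.
  - by rewrite mulr1 eb vv.
  move=> t0 [t01 et0 lt0]; exists (b * t0); split => //.
  - by apply/eqP; rewrite mulf_neq0 //; [exact/eqP|case/andP: t01 => /lt0r_neq0].
  - exact: affine_open.
  - move=> t /andP[t_ge0 t1]; rewrite -mulrA; apply: lt0.
    by apply/andP; split; nra.
(* The pair [ab] encodes the reparametrization [t] to [ab.1 + ab.2 * t]; a negative [ab.2] reverses
   an edge that was drawn starting from [v]. *)
have ex e : exists ab : R * R,
    [/\ ab.2 <> 0, 0 <= ab.1 <= 1, 0 <= ab.1 + ab.2 <= 1,
      v \notin ends e -> ab = (0, 1) &
      v \in ends e -> [/\ 0 < ab.1 + ab.2 < 1,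
       exists2 u, u != v & ends e = [set u; v]%SET /\ arc e ab.1 = pt u,
       sqdist (arc e (ab.1 + ab.2)) (pt v) = r &
       forall t, 0 <= t < 1 -> r < sqdist (arc e (ab.1 + ab.2 * t)) (pt v)]].
  have [u [w [ee e0 e1]]] := ja e.
  have [ve|ve] := boolP (v \in ends e); last first.
    by exists (0, 1); rewrite /= add0r !lexx ler01; split => //;
      apply/eqP; exact: oner_neq0.
  have uw : u != w.
    by apply/eqP => uw; have := card_ends e; rewrite ee uw finset.setUid cards1.
  have [vu|vw] : v = u \/ v = w.
    by move: ve; rewrite ee !inE => /orP[/eqP|/eqP]; [left|right].
  - have ee' : ends e = [set w; v]%SET by rewrite ee vu finset.setUC.
    have [] := @entry e 1 (-1) w ee'; rewrite ?subrr ?lexx ?ler01 ?vu //.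
    + by rewrite eq_sym.
    + by apply/eqP; rewrite oppr_eq0 oner_neq0.
    move=> c [c0 c01 ec lc]; exists (1, c) => /=; split => //.
    + by rewrite lexx ler01.
    + by rewrite !ltW //; case/andP: c01.
    move=> _; split => //; exists w; first by rewrite eq_sym.
    by rewrite -vu.
  - have [] := @entry e 0 1 u; rewrite ?add0r ?(lexx, ler01) ?vw //.
    + apply/eqP; exact: oner_neq0.
    move=> c [c0 c01 ec lc]; exists (0, c) => /=; split => //.
    + by rewrite lexx ler01.
    + by rewrite !ltW //; case/andP: c01.
    by move=> _; split => //; exists u; rewrite ?vw.
have [ab abP] := choice ex.
pose arc' e t := arc e ((ab e).1 + (ab e).2 * t).
have inner' e p : inner arc' e p -> inner arc e p.
  move=> [t t01 <-]; have [b0 a01 ab01 _ _] := abP e.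
  by exists ((ab e).1 + (ab e).2 * t) => //; exact: affine_open.
exists r, (fun e => arc e ((ab e).1 + (ab e).2)), arc'; split => //.
  by move=> e ve; have [_ _ _ _ /(_ ve)[]] := abP e.
split => //.
- split.
  + by move=> u w /(cs_pt_inj cs)/val_inj.
  + by move=> e; have [_ a01 ab01 _ _] := abP e;
      apply: within_affine => //; exact: (cs_cont cs (e := e)).
  + move=> e t t' t01 t'01; have [/eqP b0 a01 ab01 _ _] := abP e.
    move/(cs_inj cs) => h; apply: (mulfI b0); apply: (addrI (ab e).1); apply: h.
      by apply/andP; split; nra.
    by apply/andP; split; nra.
  + by move=> e u /inner'; exact: cs_avoid cs _ _.
  + move=> e1 e2 e3 p n12 n13 n23 /inner' i1 /inner' i2 /inner' i3.
    exact: (cs_no_triple cs n12 n13 n23 i1 i2 i3).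
  + by move=> e e' p ee' /inner' i /inner' i'; exact: (cs_cross cs ee' i i').
- by move=> u; apply: rpt; exact: valP u.
- move=> e t t01; have [_ _ _ far near] := abP e.
  have [ve|ve] := boolP (v \in ends e); first by have [_ _ _] := near ve; apply.
  by apply: rarc => //; rewrite far //= add0r mul1r; case/andP: t01 => -> /ltW.
- move=> e ve; have [_ _ _ /(_ ve) far _] := abP e.
  have [u [w [ee e0 e1]]] := ja e.
  have uv : u != v by apply: contraNneq ve => <-; rewrite ee !inE eqxx.
  have wv : w != v by apply: contraNneq ve => <-; rewrite ee !inE eqxx orbT.
  by exists (Sub u uv), (Sub w wv); rewrite /arc' far /= mulr0 mulr1 !add0r.
- move=> e ve; have [_ _ _ _ /(_ ve)[_ [u uv [ee eu]] _ _]] := abP e.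
  by exists (Sub u uv); rewrite /arc' /= mulr0 mulr1 addr0.
- move=> e e'; rewrite !inE => ve ve' bb'.
  have [//|/eqP ee'] := eqVneq e e'.
  have [_ _ _ _ /(_ ve)[i01 _ er _]] := abP e.
  have [_ _ _ _ /(_ ve')[i01' _ er' _]] := abP e'.
  set p := arc e _ in bb' er.
  (* Two edges with a common end on the circle would cross there in the original drawing, but no
     listed crossing has squared distance exactly [r] from [pt v]. *)
  have ps : p \in s.
    apply: (cs_cross cs ee'); first by exists ((ab e).1 + (ab e).2).
    by rewrite bb'; exists ((ab e').1 + (ab e').2).
  have : p <> pt v by move=> pv; move: r0; rewrite -er pv vv ltxx.
  by move=> /(rs p ps); rewrite er ltxx.
Qed.

(** * From the exterior of a disc to a half-plane *)

(** The horizontal offset [a] of the point from [c] is chosen positive and smaller than every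
    nonzero horizontal offset of some [b e], and below the radius. *)
Lemma circle_point (R : realType) (E : finType) (b : E -> R * R) (c : R * R)
    (r : R) : 0 < r -> exists2 t, sqdist t c = r & forall e, b e <> t.
Proof.
move=> r0; have sr0 : 0 < Num.sqrt r by rewrite sqrtr_gt0.
pose f (o : option E) := if o is Some e then
  (if (b e).1 == c.1 then 1 else `|(b e).1 - c.1|) else Num.sqrt r.
have [[e|//]|a a0 af] := @small_pos R _ f.
  by rewrite /f; case: eqVneq => // bc; rewrite normr_gt0 subr_eq0.
have ar : a ^+ 2 <= r.
  rewrite -(sqr_sqrtr (ltW r0)) lerXn2r ?nnegrE ?ltW //; exact: (af None).
exists (c.1 + a, c.2 + Num.sqrt (r - a ^+ 2)).
  by rewrite /sqdist /= ![c.1 + _]addrC ![c.2 + _]addrC !addrK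
    sqr_sqrtr ?subr_ge0 // addrC subrK.
move=> e be; have := af (Some e); rewrite /f be /= addrC addrK.
by rewrite -subr_eq0 addrK (negPf (lt0r_neq0 a0)) (gtr0_norm a0) ltxx.
Qed.

Lemma halfplane_of_drawing (R : realType) (G : mgraph) (v : vertex G) (n : nat) :
  drawable_with R G n -> exists x : edge G -> R, halfplane (@ends G) v n x.
Proof.
move=> /drawable_curve_system[pt [arc [s [cs ja sn]]]].
have [r [b [arc' [r0 br os]]]] := drawing_cut v cs ja.
set c := pt v in br os.
(* Inversion at [t] with direction [m] sends the circle to the line at height [1/2] and its exterior
   below that line; [F] then lowers everything by [1/2]. *)
have [t tc bt] := circle_point b c r0.
pose m : R * R := (c.1 - t.1, c.2 - t.2).
pose F p := inversion t m p - (0, 2^-1).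
have tU p : r < sqdist p c -> p <> t by move=> rp pt'; rewrite pt' tc ltxx in rp.
(* The numerator is minus the power of [p] with respect to the circle: zero on the circle, negative
   outside. *)
have F2 p : p <> t ->
    (F p).2 = (r - sqdist p c) / (2 * sqdist p t).
  move=> /sqr_sum_gt0; rewrite -/(sqdist p t) => d0.
  rewrite /F /inversion /= -/(sqdist p t) -tc.
  have -> : sqdist t c - sqdist p c =
    2 * ((p.1 - t.1) * (c.1 - t.1) + (p.2 - t.2) * (c.2 - t.2)) - sqdist p t.
    by rewrite /sqdist; ring.
  by field; rewrite lt0r_neq0.
have m0 : m <> 0.
  move=> [/eqP + /eqP]; rewrite !subr_eq0 => /eqP c1 /eqP c2.
  by move: r0; rewrite -tc /sqdist c1 c2 !subrr expr0n addr0 ltxx.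
exists (fun e => (F (b e)).1).
exists (F \o (pt \o val)), (fun e => F \o arc' e), (map F s).
rewrite size_map; split => //; apply: open_system_map os.
- move=> p q; rewrite !inE => Sp Sq /addIr/(inversion_inj m0); apply.
    by case: Sp => [/tU //|[e _ ->]].
  by case: Sq => [/tU //|[e _ ->]].
- move=> p Sp; have pt' : p <> t by case: Sp => [/tU //|[e _ ->]].
  by apply: cvgB; [exact: inversion_cont|exact: cvg_cst].
- move=> p rp; change ((F p).2 < 0); rewrite F2; last exact: tU.
  rewrite pmulr_llt0 ?subr_lt0 // invr_gt0 mulr_gt0 //; exact/sqr_sum_gt0/tU.
- move=> e ve; rewrite [LHS]surjective_pairing F2; last exact: bt.
  by rewrite br // subrr mul0r.
Qed.

Lemma halfplane_inj (R : realType) (V E : finType) (en : E -> {set V}) (v : V)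
    (n : nat) (x : E -> R) e e' : halfplane en v n x ->
  v \in en e -> v \in en e' -> x e = x e' -> e = e'.
Proof.
move=> [pt [arc [s [os _]]]] ve ve' xx.
by apply: (os_inj os); rewrite ?inE // xx.
Qed.

(** * Reordering the ends on the boundary line *)

Lemma increasing_interpolation (R : realType) (s : seq (R * R)) :
  sorted (fun p q => (p == q) || (p.1 < q.1) && (p.2 < q.2)) s ->
  exists phi : R -> R, [/\ continuous phi, {homo phi : a b / a < b} &
    forall p, p \in s -> phi p.1 = p.2].
Proof.
elim: s => [_|p [|q s] IH].
- by exists id; split => // a; exact: cvg_id.
- move=> _; exists (fun a => a + (p.2 - p.1)); split.
  + by move=> a; apply: cvgD; [exact: cvg_id|exact: cvg_cst].
  + by move=> a b ab; rewrite ltrD2r.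
  + by move=> u; rewrite inE => /eqP ->; rewrite addrC subrK.
move=> /andP[pq sq]; have [phi [cphi hphi phis]] := IH sq.
have [pqE|npq] := eqVneq p q.
  exists phi; split => // u; rewrite inE pqE => /orP[/eqP ->|]; last exact: phis.
  by apply: phis; rewrite mem_head.
move: pq; rewrite (negPf npq) /= => /andP[pq1 pq2].
pose k := (q.2 - p.2) / (q.1 - p.1).
have k0 : 0 < k by rewrite divr_gt0 // subr_gt0.
(* [phi] to the right of [q.1], the segment through [p] and [q] to its left *)
exists (fun a => phi (Num.max a q.1) + k * (Num.min a q.1 - q.1)); split.
- move=> a; have cmax : {for a, continuous (fun t : R => Num.max t q.1 : R^o)}.
    exact: (@continuous_max R R id (fun=> q.1) a (@cvg_id _ _) (@cvg_cst _ _ _ _ _)).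
  have cmin : {for a, continuous (fun t : R => Num.min t q.1 : R^o)}.
    exact: (@continuous_min R R id (fun=> q.1) a (@cvg_id _ _) (@cvg_cst _ _ _ _ _)).
  apply: cvgD; first exact: (cvg_comp _ _ cmax (cphi _)).
  apply: cvgM; first exact: cvg_cst.
  by apply: cvgB; [exact: cmin|exact: cvg_cst].
- move=> a b ab.
  have hle u w : u <= w -> phi u <= phi w.
    by rewrite le_eqVlt => /orP[/eqP -> //|/hphi/ltW].
  have leVlt u : q.1 <= u \/ u < q.1 by case: leP; [left|right].
  have [qb|bq] := leVlt b; rewrite /=.
    rewrite (max_idPl qb) (min_idPr qb) subrr mulr0 addr0.
    have [qa|aq] := leVlt a.
      by rewrite (max_idPl qa) (min_idPr qa) subrr mulr0 addr0 hphi.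
    rewrite (max_idPr (ltW aq)) (min_idPl (ltW aq)).
    by apply: lt_le_trans (hle _ _ qb); rewrite gtrDl pmulr_rlt0 // subr_lt0.
  have aq := lt_trans ab bq.
  rewrite !(max_idPr (ltW _)) // !(min_idPl (ltW _)) // ltrD2l ltr_pM2l //.
  by rewrite ltrD2r.
- move=> u; rewrite inE /= => /orP[/eqP ->|us].
    rewrite (max_idPr (ltW pq1)) (min_idPl (ltW pq1)) phis ?mem_head //.
    rewrite /k; field; by rewrite subr_eq0 gt_eqF.
  have tr : transitive (fun p q : R * R =>
      (p == q) || (p.1 < q.1) && (p.2 < q.2)).
    move=> w1 w2 w3 /orP[/eqP -> //|/andP[l1 l2]] /orP[/eqP <-|/andP[l3 l4]].
      by rewrite l1 l2 orbT.
    by rewrite (lt_trans l1 l3) (lt_trans l2 l4) orbT.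
  have qu : q.1 <= u.1.
    move: us; rewrite inE => /orP[/eqP -> //|us].
    have /allP/(_ _ us) := order_path_min tr sq.
    by move=> /orP[/eqP -> //|/andP[/ltW]].
  by rewrite (max_idPl qu) (min_idPr qu) subrr mulr0 addr0 phis.
Qed.

(** When [x] and [g] order the edges at [v] alike, an increasing [phi] with [phi (x e) = g e] is
    applied to all abscissas, and heights are kept. *)
Lemma halfplane_reorder (R : realType) (V E : finType) (en : E -> {set V})
    (v : V) (n : nat) (x g : E -> R) :
  {in [pred e | v \in en e] &, injective g} ->
  (forall e e', v \in en e -> v \in en e' -> g e < g e' -> x e < x e') ->
  halfplane en v n x -> halfplane en v n g.
Proof.
move=> ginj gx hx.
have xg e e' : v \in en e -> v \in en e' -> x e < x e' -> g e < g e'.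
  move=> ve ve' xx; have [//|gg|gg] := ltgtP (g e) (g e').
    by have := lt_trans xx (gx _ _ ve' ve gg); rewrite ltxx.
  by move: xx; rewrite (ginj e e') ?inE // ltxx.
pose s := sort (fun p q : R * R => p.1 <= q.1)
  [seq (x e, g e) | e <- enum [pred e | v \in en e]].
have [|phi [cphi hphi phis]] := @increasing_interpolation R s.
  apply: (@sub_in_sorted _ [pred p | p \in s] (fun p q : R * R => p.1 <= q.1)).
  - move=> p q; rewrite !inE /= !mem_sort => /mapP[e + ->] /mapP[e' + ->] /=.
    rewrite !mem_enum !inE => ve ve'; rewrite le_eqVlt => /orP[/eqP|] xx.
      by rewrite (halfplane_inj hx ve ve' xx) eqxx.
    by rewrite xx (xg e e') ?orbT.
  - exact/allP.
  - by apply: sort_sorted => p q; exact: le_total.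
have phi_inj : injective phi.
  move=> a b ab; have [h|h|//] := ltgtP a b; have := hphi _ _ h;
    by rewrite ab ltxx.
apply: (@halfplane_map R V E en v n x g (fun p => (phi p.1, p.2))) => //.
- by move=> [a b] [c d] _ _ /= [/phi_inj -> ->].
- move=> p _; have c1 : phi q.1 @[q --> p] --> phi p.1.
    apply: (@cvg_comp _ _ _ (@fst R R) phi _ (nbhs p.1)); last exact: cphi.
    exact: cvg_fst.
  exact: cvg_pair c1 cvg_snd.
- move=> e ve /=; congr (_, _); have := phis (x e, g e); apply.
  by rewrite mem_sort; apply/mapP; exists e; rewrite // mem_enum.
Qed.

(** Inversion at [(a, 0)] with direction [(0, 1)] preserves the lower half-plane and acts on its
    boundary by [y] to [1 / (y - a)]. *)
Lemma halfplane_invert (R : realType) (V E : finType) (en : E -> {set V})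
    (v : V) (n : nat) (x : E -> R) (a : R) :
  (forall e, v \in en e -> x e != a) ->
  halfplane en v n x -> halfplane en v n (fun e => (x e - a)^-1).
Proof.
move=> xa; set S := fun p : R * R => p.2 < 0 \/ exists2 e, v \in en e & p = (x e, 0).
have Sa p : S p -> p <> (a, 0).
  case=> [p2 pa|[e ve ->] [xea]]; first by rewrite pa ltxx in p2.
  by have := xa e ve; rewrite xea eqxx.
apply: (@halfplane_map R V E en v n x _ (inversion (a, 0) (0, 1))).
- move=> p q Sp Sq; apply: inversion_inj; [|exact: Sa|exact: Sa].
  by move=> [/eqP]; rewrite oner_eq0.
- by move=> p Sp; apply: inversion_cont; exact: Sa.
- move=> p p2; have /sqr_sum_gt0 /= d0 : p <> (a, 0) by apply: Sa; left.
  by rewrite /inversion /= mulr0 add0r mulr1 subr0 pmulr_llt0 // invr_gt0 -[p.2]subr0.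
- move=> e ve; rewrite /inversion /= !subr0 !mulr0 mulr1 mul0r subr0 add0r mul0r.
  rewrite expr0n addr0 expr2 invfM mulrA divff ?mul1r // subr_eq0; exact: xa.
Qed.

(* Inversion at a point just to the right of [x e1] moves [e1] to the far left
   and reverses the order of the edges to the right of [e1]. *)
Lemma halfplane_lowest (R : realType) (V E : finType) (en : E -> {set V})
    (v : V) (n : nat) (x : E -> R) e1 :
  v \in en e1 -> halfplane en v n x -> exists x' : E -> R, [/\ halfplane en v n x',
    forall e, v \in en e -> e != e1 -> x' e1 < x' e &
    forall e e', v \in en e -> v \in en e' -> x e1 < x e -> x e < x e' ->
      x' e' < x' e].
Proof.
move=> ve1 hx.
(* The distance [d] is smaller than every gap to the right of [x e1], so [e1] is the last edge to
   the left of the centre [a]. *)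
pose f e := if x e1 < x e then x e - x e1 else 1.
have [e|d d0 df] := @small_pos R _ f.
  by rewrite /f; case: ifP => // h; rewrite subr_gt0.
pose a := x e1 + d.
have ae e : x e1 < x e -> a < x e.
  by move=> h; have := df e; rewrite /f h /a ltrBrDl.
have e1a : x e1 < a by rewrite /a ltrDl.
have xa e : v \in en e -> x e != a.
  move=> ve; apply/eqP => xea; have := ae e; rewrite xea ltxx => h.
  by have := h e1a.
exists (fun e => (x e - a)^-1); split; first exact: halfplane_invert.
- move=> e ve ee1; have [h|h|h] := ltgtP (x e1) (x e).
  + have ha := ae _ h; apply: (@lt_trans _ _ 0); first by rewrite invr_lt0 subr_lt0.
    by rewrite invr_gt0 subr_gt0.
  + have ha := lt_trans h e1a.
    rewrite ltf_nV2 ?negrE ?subr_lt0 //; by rewrite ltrD2r.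
  + by have := halfplane_inj hx ve1 ve h => E1; rewrite E1 eqxx in ee1.
- move=> e e' ve ve' he he'; have ha := ae _ he.
  by rewrite ltf_pV2 ?posrE ?subr_gt0 ?ltrD2r // (lt_trans ha).
Qed.

(** Let [e1], [e2], [e3] be the edges at [v] in the order of [g]. One inversion puts [e1] lowest,
    and then at most [e2] and [e3] are in the wrong order. *)
Lemma halfplane_three (R : realType) (V E : finType) (en : E -> {set V})
    (v : V) (n : nat) (x g : E -> R) :
  #|[set e | v \in en e]%SET| = 3%N -> {in [pred e | v \in en e] &, injective g} ->
  halfplane en v n x -> halfplane en v n g.
Proof.
move=> d3 ginj hx.
pose s := sort (fun e e' => g e <= g e') (enum [set e | v \in en e]%SET).
have ms e : (e \in s) = (v \in en e) by rewrite mem_sort mem_enum inE.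
have us : uniq s by rewrite sort_uniq enum_uniq.
have ss : sorted (fun e e' => g e <= g e') s.
  by apply: sort_sorted => e e'; exact: le_total.
have szs : size s = 3%N by rewrite size_sort -cardE.
case: s ms us ss szs => [|e1 [|e2 [|e3 []]]] // ms us /= /and3P[g12 g23 _] _.
have ve1 : v \in en e1 by rewrite -ms !inE eqxx.
have ve2 : v \in en e2 by rewrite -ms !inE eqxx orbT.
have ve3 : v \in en e3 by rewrite -ms !inE eqxx !orbT.
have [n12 n13 n23] : [/\ e1 != e2, e1 != e3 & e2 != e3].
  by move: us; rewrite /= !inE !negb_or => /andP[/andP[-> ->] /andP[-> _]].
have done_ (y : E -> R) : halfplane en v n y -> y e1 < y e2 -> y e2 < y e3 ->
    halfplane en v n g.
  move=> hy y12 y23; apply: (halfplane_reorder ginj _ hy) => e e'; rewrite -!ms !inE.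
  have y13 := lt_trans y12 y23; have g13 := le_trans g12 g23.
  by move=> /or3P[] /eqP -> /or3P[] /eqP -> //; rewrite ?ltxx // ltNge ?g12 ?g13 ?g23.
have [y [hy ylow _]] := halfplane_lowest ve1 hx.
have y12 := ylow _ ve2; rewrite eq_sym in n12.
have y13 := ylow _ ve3; rewrite eq_sym in n13.
have [h|h|h] := ltgtP (y e2) (y e3).
- exact: done_ hy (y12 n12) h.
(* As [e1] is lowest already, a second inversion keeps it there and exchanges [e2] and [e3]. *)
- have [z [hz zlow zrev]] := halfplane_lowest ve1 hy.
  by apply: done_ hz (zlow _ ve2 n12) _; apply: zrev => //; exact: y13.
- by move: n23; rewrite (halfplane_inj hy ve2 ve3 h) eqxx.
Qed.


(** The element of a given rank under [g] is sent by [h] to the element of the same rank under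
    [x]. *)
Lemma order_matching (R : realType) (T : finType) (x g : T -> R) :
  injective x -> injective g -> exists2 h : T -> T, injective h &
    forall t t', g t < g t' -> x (h t) < x (h t').
Proof.
pose rk (f : T -> R) t := #|[set t' | f t' < f t]%SET|.
have rk_lt f t t' : f t < f t' -> (rk f t < rk f t')%N.
  move=> h; apply: proper_card; apply/properP; split.
    by apply/fintype.subsetP => u; rewrite !inE => /lt_trans; apply.
  by exists t; rewrite !inE ?ltxx.
have rkT f t : (rk f t < #|T|)%N.
  rewrite /rk -cardsT; apply: proper_card; apply/properP; split.
    by apply/fintype.subsetP => u; rewrite inE.
  by exists t; rewrite !inE ?ltxx.
pose rko f t := Ordinal (rkT f t).
have rko_inj f : injective f -> injective (rko f).
  move=> finj t t' [] h; have [hl|hl|/finj //] := ltgtP (f t) (f t').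
    by have := rk_lt _ _ _ hl; rewrite h ltnn.
  by have := rk_lt _ _ _ hl; rewrite h ltnn.
move=> xinj ginj.
have [k kK Kk] : bijective (rko x).
  by apply: inj_card_bij; [exact: rko_inj|rewrite card_ord].
exists (k \o rko g).
  by apply: inj_comp; [exact: can_inj Kk|exact: rko_inj].
move=> t t' gt; have := rk_lt _ _ _ gt.
have rkE u : rk g u = rk x ((k \o rko g) u) by have /(congr1 val) := Kk (rko g u).
rewrite !rkE.
have [//|h|/xinj ->] := ltgtP (x ((k \o rko g) t)) (x ((k \o rko g) t')).
  by move=> h2; have := ltn_trans (rk_lt _ _ _ h) h2; rewrite ltnn.
by rewrite ltnn.
Qed.

(** The picture stays the same and only the labels change: [u] takes the point of [p u], and [e] the
    curve of [q e]. *)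
Lemma halfplane_aut (R : realType) (V E : finType) (en : E -> {set V}) (v : V)
    (n : nat) (x : E -> R) (p : {perm V}) (q : {perm E}) :
  p v = v -> (forall e, en (q e) = p @: en e) ->
  halfplane en v n x -> halfplane en v n (x \o q).
Proof.
move=> pv qe [pt [arc [s [os sn]]]].
have pn u : u != v -> p u != v by move=> uv; rewrite -pv (inj_eq perm_inj).
pose P (u : {u | u != v}) : {u | u != v} := Sub (p (val u)) (pn _ (valP u)).
have Pinj : injective P by move=> u w [/perm_inj/val_inj].
have Psurj w : exists u, w = P u.
  have wv : (p^-1)%g (val w) != v.
    by rewrite -(inj_eq (@perm_inj _ p)) permKV pv; exact: valP w.
  by exists (Sub ((p^-1)%g (val w)) wv); apply: val_inj; rewrite /= permKV.
have vq e : (v \in en (q e)) = (v \in en e).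
  by rewrite qe -{1}pv mem_imset //; exact: perm_inj.
have en2 e u w : en (q e) = [set p u; p w]%SET -> en e = [set u; w]%SET.
  rewrite qe => h; apply: (imset_inj (@perm_inj _ p)).
  by rewrite h imsetU1 imset_set1.
exists (pt \o P), (arc \o q), s; split => //; split.
- split.
  + by move=> u w /(cs_pt_inj (os_cs os))/Pinj.
  + by move=> e; exact: (cs_cont (os_cs os) (e := q e)).
  + by move=> e t t'; exact: (cs_inj (os_cs os)).
  + by move=> e u; exact: (cs_avoid (os_cs os)).
  + move=> e1 e2 e3 y n12 n13 n23.
    by apply: (cs_no_triple (os_cs os)) => /perm_inj.
  + by move=> e e' y ee'; apply: (cs_cross (os_cs os)) => /perm_inj.
- by move=> u; exact: os_pt os _.
- by move=> e t; exact: os_arc os _ _.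
- move=> e; rewrite -vq => /(os_far os)[u [w [ee e0 e1]]].
  have [[u' uE] [w' wE]] := (Psurj u, Psurj w).
  exists u', w'; rewrite /= -uE -wE; split => //; apply: en2.
  by rewrite ee uE wE.
- move=> e; rewrite -vq => /(os_near os)[u [ee e0 e1]].
  have [u' uE] := Psurj u.
  exists u'; rewrite /= -uE; split => //; apply: en2.
  by rewrite ee uE pv.
- move=> e e'; rewrite !inE -(vq e) -(vq e') => ve ve' /= h.
  by apply: (@perm_inj _ q); apply: (os_inj os).
Qed.

Lemma nbhd_edge (G : mgraph) (v : vertex G) (e : edge G) : v \in ends e ->
  exists2 u, u \in nbhd v & ends e = [set u; v]%SET.
Proof.
move=> ve; have [a [b [ab ee]]] : exists a b, a != b /\ ends e = [set a; b]%SET.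
  by apply/cards2P; rewrite card_ends.
have [av|bv] : v = a \/ v = b.
  by move: ve; rewrite ee !inE => /orP[/eqP|/eqP]; [left|right].
  exists b; last by rewrite ee av finset.setUC.
  by rewrite inE; apply/existsP; exists e; rewrite ee av finset.setUC.
exists a; last by rewrite ee bv.
by rewrite inE; apply/existsP; exists e; rewrite ee bv.
Qed.

Lemma pair_inj (T : finType) (a b c : T) :
  a != c -> [set a; c]%SET = [set b; c]%SET -> a = b.
Proof.
move=> ac /setP/(_ a); rewrite !inE eqxx (negPf ac) /= orbF => /esym/eqP.
exact.
Qed.

Lemma pt_stab1P (G : mgraph) (v : vertex G) (p : {perm vertex G}) :
  p \in pt_stab [set v]%SET ->
  p v = v /\ exists q : {perm edge G}, forall e, ends (q e) = p @: ends e.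
Proof.
rewrite inE => /andP[]; rewrite inE => /existsP[q /forallP qe].
move=> /astabP/(_ v); rewrite inE eqxx => /(_ isT) /= pv.
by split; [exact: pv|exists q => e; apply/eqP; exact: qe].
Qed.

(** The rank-preserving matching [h] of the edges at [v] induces a permutation of the neighbours.
    Homogeneity extends it to an automorphism fixing [v], and relabelling by that automorphism
    produces the order of [g]. *)
Lemma halfplane_homogeneous (R : realType) (G : mgraph) (v : vertex G) (n : nat)
    (x g : edge G -> R) :
  simple_vertex v -> homogeneous_nbhd v ->
  {in [pred e | v \in ends e] &, injective g} ->
  halfplane (@ends G) v n x -> halfplane (@ends G) v n g.
Proof.
move=> simple hom ginj hx.
pose T := {e : edge G | v \in ends e}.
have [||h hinj hord] := @order_matching R T (x \o val) (g \o val).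
- by move=> t t' /= /(halfplane_inj hx (valP t) (valP t'))/val_inj.
- by move=> t t' /= /ginj h; apply: val_inj; apply: h; rewrite inE;
    [exact: (valP t)|exact: (valP t')].
have other (t : T) : exists u, u \in nbhd v /\ ends (val t) = [set u; v]%SET.
  by have [u] := nbhd_edge (valP t); exists u.
have [w wP] := choice other.
have winj : injective w.
  move=> t t' oo; apply: val_inj; apply: (simple _ _ (valP t)).
  by have [_ ->] := wP t; have [_ ->] := wP t'; rewrite oo.
(* The neighbour at the other end of [t] goes to the one at the other end of [h t]; all other
   vertices are fixed. *)
pose S u := if [pick t | w t == u] is Some t then w (h t) else u.
have Sw t : S (w t) = w (h t).
  rewrite /S; case: pickP => [t' /eqP/winj -> //|/(_ t)]; by rewrite eqxx.
have Sn u : (forall t, w t != u) -> S u = u.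
  move=> ou; rewrite /S; case: pickP => // t /eqP ot.
  by have := ou t; rewrite ot eqxx.
have oV u : (exists t, u = w t) \/ forall t, w t != u.
  have [/existsP[t /eqP ot]|/existsPn] := boolP [exists t, w t == u].
    by left; exists t.
  by right.
have Sinj : injective S.
  move=> a b; have [[t ->]|na] := oV a; have [[t' ->]|nb] := oV b.
  - by rewrite !Sw => /winj/hinj ->.
  - by rewrite Sw (Sn b) // => hb; have := nb (h t); rewrite hb eqxx.
  - by rewrite Sw (Sn a) // => hb; have := na (h t'); rewrite -hb eqxx.
  - by rewrite !Sn.
have Son : perm_on (nbhd v) (perm Sinj).
  apply/fintype.subsetP => u; rewrite inE permE => Su.
  have [[t ->]|nu] := oV u; first by have [] := wP t.
  by rewrite Sn // eqxx in Su.
have [p pst pS] := hom _ Son.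
have [pv [q qe]] := pt_stab1P pst.
(* Both edges have the same ends, one of them [v], so they coincide because [v] is simple. *)
have qh t : q (val t) = val (h t).
  have [ot et] := wP t; have [oht eht] := wP (h t).
  have e1 : ends (q (val t)) = ends (val (h t)).
    by rewrite qe et imsetU1 imset_set1 pv pS // permE Sw eht.
  by apply: (simple _ _ _ e1); rewrite e1; exact: (valP (h t)).
apply: (halfplane_reorder ginj _ (halfplane_aut pv qe hx)) => e e' ve ve' gg.
by rewrite /= (qh (Sub e ve)) (qh (Sub e' ve')); exact: hord.
Qed.

(** * Gluing *)

Definition flip (R : realType) (p : R * R) : R * R := (p.1, - p.2).

Lemma flipK (R : realType) : involutive (@flip R).
Proof. by case=> a b; rewrite /flip /= opprK. Qed.

Lemma flip_cont (R : realType) : continuous (@flip R).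
Proof.
move=> p; have c2 : (fun q : R * R => - q.2) q @[q --> p] --> - p.2.
  by apply: cvgN; exact: cvg_snd.
exact: cvg_pair cvg_fst c2.
Qed.

(** The path follows [f] to [z] and then [g] backwards. The two halves cannot meet again, since the
    second coordinate is nonpositive on the first and positive on the second. *)
Lemma path_concat (R : realType) (f g : R -> R * R) (z : R * R) :
  {within `[0, 1], continuous f} -> {within `[0, 1], continuous g} ->
  (forall t t', 0 <= t <= 1 -> 0 <= t' <= 1 -> f t = f t' -> t = t') ->
  (forall t t', 0 <= t <= 1 -> 0 <= t' <= 1 -> g t = g t' -> t = t') ->
  f 1 = z -> g 1 = z -> z.2 = 0 ->
  (forall t, 0 <= t < 1 -> (f t).2 < 0) ->
  (forall t, 0 <= t < 1 -> 0 < (g t).2) ->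
  exists h : R -> R * R, [/\ {within `[0, 1], continuous h},
    forall t t', 0 <= t <= 1 -> 0 <= t' <= 1 -> h t = h t' -> t = t',
    h 0 = f 0, h 1 = g 0 &
    forall t, 0 < t < 1 -> h t = z \/
      exists2 t', 0 < t' < 1 & h t = f t' \/ h t = g t'].
Proof.
move=> cf cg finj ginj f1 g1 z2 fneg gpos.
(* The summand not being traversed is constantly [z]. *)
pose h t := f (clamp (2 * t)) + g (clamp (2 - 2 * t)) - z.
have hl (t : R) : 0 <= t <= 2^-1 -> h t = f (2 * t).
  move=> t01; rewrite /h clampE; last by lra.
  have -> : clamp (2 - 2 * t) = 1.
    by rewrite /clamp (max_idPl _) ?(min_idPr _) //; lra.
  by rewrite g1 addrK.
have hr (t : R) : 2^-1 <= t <= 1 -> h t = g (2 - 2 * t).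
  move=> t01; rewrite /h [clamp (_ - _)]clampE; last by lra.
  have -> : clamp (2 * t) = 1.
    by rewrite /clamp (max_idPl _) ?(min_idPr _) //; lra.
  by rewrite f1 addrAC subrr add0r.
have split01 (t : R) : 0 <= t <= 1 -> 0 <= t <= 2^-1 \/ 2^-1 < t <= 1.
  by move=> /andP[t0 t1]; have [h2|h2] := leP t 2^-1; [left|right]; apply/andP.
have hneg (t : R) : 0 <= t <= 2^-1 -> (h t).2 <= 0.
  move=> t01; rewrite hl //; have [h1|h1] := ltP (2 * t) 1.
    by apply: ltW; apply: fneg; lra.
  have -> : 2 * t = 1 by lra.
  by rewrite f1 z2.
have hpos (t : R) : 2^-1 < t <= 1 -> 0 < (h t).2.
  by move=> t01; rewrite hr; [apply: gpos|]; lra.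
exists h; split.
- apply: continuous_subspaceT => t; apply: cvgB; last exact: cvg_cst.
  have ca : continuous (fun t : R => 2 * t).
    by move=> s; apply: cvgM; [exact: cvg_cst|exact: cvg_id].
  have cc : continuous (fun t : R => clamp (2 * t)).
    move=> s; exact: (cvg_comp _ _ (ca s) (@clamp_cont R _)).
  have cb : continuous (fun t : R => 2 - 2 * t).
    by move=> s; apply: cvgB; [exact: cvg_cst|exact: ca].
  have cd : continuous (fun t : R => clamp (2 - 2 * t)).
    move=> s; exact: (cvg_comp _ _ (cb s) (@clamp_cont R _)).
  apply: cvgD.
    by apply: (within_reparam cf cc) => s; exact: clamp01.
  by apply: (within_reparam cg cd) => s; exact: clamp01.
- move=> t t' /split01[t01|t01] /split01[t01'|t01'].
  + rewrite !hl // => /finj E; have tt : 2 * t = 2 * t' by apply: E; lra.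
    by lra.
  + by move=> hh; have := hneg _ t01; rewrite hh leNgt hpos.
  + by move=> hh; have := hpos _ t01; rewrite hh ltNge hneg.
  + rewrite !hr; [|lra|lra]; move=> /ginj E.
    have tt : 2 - 2 * t = 2 - 2 * t' by apply: E; lra.
    by lra.
- by rewrite hl ?mulr0 //; lra.
- by rewrite hr ?mulr1 ?subrr //; lra.
- move=> t t01; have [h1|h1|h1] := ltgtP t 2^-1.
  + by right; exists (2 * t); [lra|left; rewrite hl //; lra].
  + by right; exists (2 - 2 * t); [lra|right; rewrite hr //; lra].
  + by left; rewrite h1 hl ?divff ?f1 //; lra.
Qed.

(** An edge of [K] follows a curve of the first drawing, a reflected curve of the second, or one of
    each joined on the axis. The relations [r1] and [r2] tell which curves it follows; no curve
    serves two edges, and curves related to no edge are dropped. *)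
Lemma glue_halfplanes (R : realType) (V1 V2 E1 E2 : finType)
    (en1 : E1 -> {set V1}) (en2 : E2 -> {set V2}) (v1 : V1) (v2 : V2)
    (n1 n2 : nat) (x1 : E1 -> R) (x2 : E2 -> R) (K : mgraph)
    (f : vertex K -> {u | u != v1} + {u | u != v2})
    (r1 : edge K -> E1 -> Prop) (r2 : edge K -> E2 -> Prop) :
  injective f ->
  (forall e e' a, r1 e a -> r1 e' a -> e = e') ->
  (forall e e' b, r2 e b -> r2 e' b -> e = e') ->
  (forall e, [\/ exists a, [/\ r1 e a, v1 \notin en1 a & forall u w,
        en1 a = [set val u; val w]%SET -> exists i j,
        [/\ ends e = [set i; j]%SET, f i = inl u & f j = inl w]],
      exists b, [/\ r2 e b, v2 \notin en2 b & forall u w,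
        en2 b = [set val u; val w]%SET -> exists i j,
        [/\ ends e = [set i; j]%SET, f i = inr u & f j = inr w]] |
      exists a b, [/\ r1 e a /\ r2 e b, v1 \in en1 a, v2 \in en2 b,
        x1 a = x2 b & forall u w,
        en1 a = [set val u; v1]%SET -> en2 b = [set val w; v2]%SET ->
        exists i j, [/\ ends e = [set i; j]%SET, f i = inl u & f j = inr w]]]) ->
  halfplane en1 v1 n1 x1 -> halfplane en2 v2 n2 x2 ->
  exists2 n, drawable_with R K n & (n <= n1 + n2)%N.
Proof.
move=> finj r1inj r2inj edges h1 h2.
have x1inj := halfplane_inj h1.
move: h1 h2 => [pt1 [arc1 [s1 [os1 sn1]]]] [pt2 [arc2 [s2 [os2 sn2]]]].
pose pt k := match f k with inl u => pt1 u | inr w => flip (pt2 w) end.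
(* An interior point of a glued edge is traced back to the drawing it comes from by the sign of its
   height. *)
pose desc e (p : R * R) :=
  [\/ p.2 < 0 /\ exists a, r1 e a /\ inner arc1 a p,
      0 < p.2 /\ exists b, r2 e b /\ inner arc2 b (flip p) |
      p.2 = 0 /\ exists a, [/\ r1 e a, v1 \in en1 a & p = (x1 a, 0)]].
have pt1neg u : (pt1 u).2 < 0 := os_pt os1 u.
have pt2pos u : 0 < (flip (pt2 u)).2 by rewrite oppr_gt0; exact: os_pt os2 u.
have inner1 a t : 0 < t < 1 -> (arc1 a t).2 < 0 /\ inner arc1 a (arc1 a t).
  move=> t01; split; last by exists t.
  by apply: (os_arc os1); case/andP: t01 => /ltW -> ->.
have inner2 b t : 0 < t < 1 -> 0 < (flip (arc2 b t)).2 /\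
    inner arc2 b (flip (flip (arc2 b t))).
  move=> t01; rewrite flipK; split; last by exists t.
  by rewrite oppr_gt0; apply: (os_arc os2); case/andP: t01 => /ltW -> ->.
have cflip b : {within `[0, 1], continuous (@flip R \o arc2 b)}.
  apply: within_comp; first exact: (cs_cont (os_cs os2) (e := b)).
  by move=> t _; exact: flip_cont.
have flip_inj b t t' : 0 <= t <= 1 -> 0 <= t' <= 1 ->
    flip (arc2 b t) = flip (arc2 b t') -> t = t'.
  move=> t01 t01' /(inv_inj (@flipK R)); exact: (cs_inj (os_cs os2)).
have curve e : exists h : R -> R * R, [/\ {within `[0, 1], continuous h},
    forall t t', 0 <= t <= 1 -> 0 <= t' <= 1 -> h t = h t' -> t = t',
    forall t, 0 < t < 1 -> desc e (h t) &
    exists u w, [/\ ends e = [set u; w]%SET, h 0 = pt u & h 1 = pt w]].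
  have [[a [ra va ea]]|[b [rb vb eb]]|[a [b [[ra rb] va vb xab eab]]]] := edges e.
  - have [u [w [ee a0 a1]]] := os_far os1 va.
    have [i [j [eij fi fj]]] := ea _ _ ee.
    exists (arc1 a); split.
    + exact: (cs_cont (os_cs os1) (e := a)).
    + by move=> t t'; exact: (cs_inj (os_cs os1)).
    + move=> t /(inner1 a)[neg ia]; apply: Or31; split => //; by exists a.
    + by exists i, j; rewrite /pt fi fj.
  - have [u [w [ee b0 b1]]] := os_far os2 vb.
    have [i [j [eij fi fj]]] := eb _ _ ee.
    exists (@flip R \o arc2 b); split => //.
    + exact: flip_inj.
    + move=> t /(inner2 b)[pos ib]; apply: Or32; split => //; by exists b.
    + by exists i, j; rewrite /pt fi fj /= b0 b1.
  - have [u [eu a0 a1]] := os_near os1 va.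
    have [w [ew b0 b1]] := os_near os2 vb.
    have [i [j [eij fi fj]]] := eab _ _ eu ew.
    have [] := @path_concat R (arc1 a) (@flip R \o arc2 b) (x1 a, 0) => //.
    + exact: (cs_cont (os_cs os1) (e := a)).
    + by move=> t t'; exact: (cs_inj (os_cs os1)).
    + exact: flip_inj.
    + by rewrite /= b1 /flip /= oppr0 xab.
    + by move=> t t01; exact: (os_arc os1).
    + by move=> t t01; rewrite /= oppr_gt0; exact: (os_arc os2).
    move=> h [ch hinj h0 h1 hin]; exists h; split => //.
    + move=> t /hin[->|[t' t01 [->|->]]].
      * by apply: Or33; split => //; exists a.
      * by have [neg ia] := inner1 a t' t01; apply: Or31; split => //; exists a.
      * by have [pos ib] := inner2 b t' t01; apply: Or32; split => //; exists b.
    + by exists i, j; rewrite /pt fi fj h0 h1 a0 /= b0.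
have [arc arcP] := choice curve.
have innerE e p : inner arc e p -> desc e p.
  by move=> [t t01 <-]; have [_ _ + _] := arcP e; apply.
have neg e p : p.2 < 0 -> inner arc e p -> exists a, r1 e a /\ inner arc1 a p.
  move=> p2 /innerE[[] //|[p2' _]|[p2' _]].
    by have := lt_trans p2 p2'; rewrite ltxx.
  by rewrite p2' ltxx in p2.
have pos e p : 0 < p.2 -> inner arc e p ->
    exists b, r2 e b /\ inner arc2 b (flip p).
  move=> p2 /innerE[[p2' _]|[] //|[p2' _]].
    by have := lt_trans p2 p2'; rewrite ltxx.
  by rewrite p2' ltxx in p2.
(* No crossing arises on the axis, because distinct edges at [v1] end at distinct points. *)
have zero e e' p : p.2 = 0 -> inner arc e p -> inner arc e' p -> e = e'.
  have z p' e0 : p'.2 = 0 -> inner arc e0 p' ->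
      exists a, [/\ r1 e0 a, v1 \in en1 a & p' = (x1 a, 0)].
    by move=> p2 /innerE[[]|[]|[] //]; rewrite p2 ltxx.
  move=> p2 /(z _ _ p2)[a [ra va pa]] /(z _ _ p2)[a' [ra' va' pa']].
  have aa : a = a' by apply: x1inj => //; move: pa'; rewrite pa => -[].
  by apply: (r1inj _ _ a) => //; rewrite aa.
have cs : curve_system pt arc (s1 ++ map (@flip R) s2).
  split.
  - move=> k k'; rewrite /pt; case Ek: (f k) => [u|u]; case Ek': (f k') => [w|w].
    + by move/(cs_pt_inj (os_cs os1)) => uw; apply: finj; rewrite Ek Ek' uw.
    + move=> h; have := lt_trans (pt1neg u) (pt2pos w).
      by rewrite h ltxx.
    + move=> h; have := lt_trans (pt1neg w) (pt2pos u).
      by rewrite h ltxx.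
    + move/(inv_inj (@flipK R))/(cs_pt_inj (os_cs os2)) => uw.
      by apply: finj; rewrite Ek Ek' uw.
  - by move=> e; have [] := arcP e.
  - by move=> e; have [] := arcP e.
  - move=> e k; rewrite /pt; case: (f k) => u.
      by move=> /(neg _ _ (pt1neg u))[a [_]]; exact: (cs_avoid (os_cs os1)).
    move=> /(pos _ _ (pt2pos u))[b [_]]; rewrite flipK.
    exact: (cs_avoid (os_cs os2)).
  - move=> e e' e3 p n12 n13 n23; have [p2|p2|p2] := ltgtP p.2 0.
    + move=> /(neg _ _ p2)[a [ra ia]] /(neg _ _ p2)[a' [ra' ia']].
      move=> /(neg _ _ p2)[a3 [ra3 ia3]].
      apply: (cs_no_triple (os_cs os1) _ _ _ ia ia' ia3) => aa.
      * by apply: n12; apply: (r1inj _ _ a) => //; rewrite aa.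
      * by apply: n13; apply: (r1inj _ _ a) => //; rewrite aa.
      * by apply: n23; apply: (r1inj _ _ a') => //; rewrite aa.
    + move=> /(pos _ _ p2)[a [ra ia]] /(pos _ _ p2)[a' [ra' ia']].
      move=> /(pos _ _ p2)[a3 [ra3 ia3]].
      apply: (cs_no_triple (os_cs os2) _ _ _ ia ia' ia3) => aa.
      * by apply: n12; apply: (r2inj _ _ a) => //; rewrite aa.
      * by apply: n13; apply: (r2inj _ _ a) => //; rewrite aa.
      * by apply: n23; apply: (r2inj _ _ a') => //; rewrite aa.
    + by move=> i i'; have := zero _ _ _ p2 i i'.
  - move=> e e' p ee' i i'; rewrite mem_cat; have [p2|p2|p2] := ltgtP p.2 0.
    + have [a [ra ia]] := neg _ _ p2 i; have [a' [ra' ia']] := neg _ _ p2 i'.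
      rewrite (cs_cross (os_cs os1) _ ia ia') // => aa.
      by apply: ee'; apply: (r1inj _ _ a) => //; rewrite aa.
    + have [a [ra ia]] := pos _ _ p2 i; have [a' [ra' ia']] := pos _ _ p2 i'.
      rewrite -[p]flipK map_f ?orbT //; apply: (cs_cross (os_cs os2) _ ia ia') => aa.
      by apply: ee'; apply: (r2inj _ _ a) => //; rewrite aa.
    + by case: ee'; exact: zero p2 i i'.
have [n dn ns] : exists2 n, drawable_with R K n & (n <= size (s1 ++ map (@flip R) s2))%N.
  apply: curve_system_drawable cs _ => e.
  by have [_ _ _] := arcP e.
exists n => //; apply: leq_trans ns _; rewrite size_cat size_map; exact: leq_add.
Qed.

(** * Existence of drawings *)

(** Open arc between the zeros [a] and [b] of a parabola. Different values of [k] leave at most two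
    common points, even when the zeros agree, as for parallel edges. *)
Definition on_parabola (R : realType) (a b k : R) (p : R * R) : Prop :=
  a < p.1 < b /\ p.2 = k * ((p.1 - a) * (b - p.1)).

Lemma quadratic_roots (R : realType) (q B C : R) : q != 0 ->
  exists s : seq R, forall x, q * x ^+ 2 + B * x + C = 0 -> x \in s.
Proof.
move=> q0; pose D := B ^+ 2 - 4 * q * C.
exists [:: (Num.sqrt D - B) / (2 * q); (- Num.sqrt D - B) / (2 * q)] => x qx.
(* Completing the square also shows that [D] is nonnegative as soon as a root exists, so
   [Num.sqrt D] is a true square root. *)
have D2 : (2 * q * x + B) ^+ 2 = D.
  have -> : (2 * q * x + B) ^+ 2 = 4 * q * (q * x ^+ 2 + B * x + C) + D.
    by rewrite /D; ring.
  by rewrite qx mulr0 add0r.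
have xE y : 2 * q * x + B = y -> x = (y - B) / (2 * q).
  by move=> <-; rewrite addrK mulrC mulKf // mulf_neq0 ?pnatr_eq0.
have /eqP : (2 * q * x + B) ^+ 2 = Num.sqrt D ^+ 2.
  by rewrite sqr_sqrtr // -D2 sqr_ge0.
by rewrite eqf_sqr !inE => /orP[/eqP/xE ->|/eqP/xE ->]; rewrite eqxx ?orbT.
Qed.

Lemma parabolas_meet (R : realType) (a b k a' b' k' : R) : k != k' ->
  exists s : seq (R * R), forall p,
    on_parabola a b k p -> on_parabola a' b' k' p -> p \in s.
Proof.
move=> kk'; have q0 : k' - k != 0 by rewrite subr_eq0 eq_sym.
have [s sP] := @quadratic_roots R _ (k * (a + b) - k' * (a' + b'))
  (k' * (a' * b') - k * (a * b)) q0.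
exists [seq (x, k * ((x - a) * (b - x))) | x <- s] => -[x y] [_ /= yE] [_ /= yE'].
rewrite yE; apply: (map_f (fun x => (x, k * ((x - a) * (b - x))))); apply: sP.
have : k * ((x - a) * (b - x)) = k' * ((x - a') * (b' - x)) by rewrite -yE.
by move/eqP; rewrite -subr_eq0 => /eqP <-; ring.
Qed.

Lemma fresh_pos (R : realType) (s : seq R) : exists2 k, 0 < k & k \notin s.
Proof.
suff [k k0 sk] : exists2 k, 0 < k & forall x, x \in s -> x < k.
  by exists k => //; apply/negP => /sk; rewrite ltxx.
elim: s => [|y s [k k0 sk]]; first by exists 1.
exists (k + `|y|); first by rewrite ltr_wpDr.
move=> x; rewrite inE => /orP[/eqP ->|/sk xk]; last by rewrite ltr_wpDr.
by apply: le_lt_trans (ler_norm y) _; rewrite ltrDr.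
Qed.

(** Coefficients are chosen one edge at a time; each has to avoid only finitely many values. *)
Lemma generic_parabolas (R : realType) (E : finType) (a b : E -> R) (l : seq E) :
  exists k : E -> R, [/\ forall e, 0 < k e, {in l &, injective k} &
    forall e1 e2 e3 p, e1 \in l -> e2 \in l -> e3 \in l ->
      e1 <> e2 -> e1 <> e3 -> e2 <> e3 ->
      on_parabola (a e1) (b e1) (k e1) p -> on_parabola (a e2) (b e2) (k e2) p ->
      on_parabola (a e3) (b e3) (k e3) p -> False].
Proof.
elim: l => [|e l [k [k0 kinj ktriple]]]; first by exists (fun=> 1); split.
have [el|el] := boolP (e \in l).
  have sub e' : (e' \in e :: l) = (e' \in l).
    by rewrite inE; case: eqP => // ->; rewrite el.
  exists k; split => //; first by move=> e1 e2; rewrite !sub; exact: kinj.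
  by move=> e1 e2 e3 p; rewrite !sub; exact: ktriple.
have meet (ee : E * E) : exists s : seq (R * R), k ee.1 != k ee.2 -> forall p,
    on_parabola (a ee.1) (b ee.1) (k ee.1) p ->
    on_parabola (a ee.2) (b ee.2) (k ee.2) p -> p \in s.
  have [_|kk] := eqVneq (k ee.1) (k ee.2); first by exists [::].
  by have [s sP] := @parabolas_meet R (a ee.1) (b ee.1) _ (a ee.2) (b ee.2) _ kk;
    exists s.
have [S SP] := choice meet.
pose pts := flatten [seq S (e1, e2) | e1 <- l, e2 <- l].
(* Forbidden are the earlier coefficients and, for each meeting point [p] of two earlier parabolas,
   the coefficient that would make the new one pass through [p]. *)
have [c c0] := @fresh_pos R (map k l ++
  [seq p.2 / ((p.1 - a e) * (b e - p.1)) | p <- pts]).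
rewrite mem_cat negb_or => /andP[ck cpts].
pose k' e' := if e' == e then c else k e'.
have k'l e' : e' \in l -> k' e' = k e'.
  by rewrite /k'; case: eqP => // ->; rewrite (negPf el).
have k'e : k' e = c by rewrite /k' eqxx.
have new e1 e2 p : e1 \in l -> e2 \in l -> e1 <> e2 ->
    on_parabola (a e1) (b e1) (k' e1) p -> on_parabola (a e2) (b e2) (k' e2) p ->
    on_parabola (a e) (b e) (k' e) p -> False.
  move=> l1 l2 n12; rewrite k'e (k'l _ l1) (k'l _ l2) => o1 o2 [/andP[ap pb] pE].
  move/negP: cpts; apply; apply/mapP; exists p.
    apply/flattenP; exists (S (e1, e2)); first exact/allpairsP/(ex_intro _ (e1, e2)).
    apply: (SP (e1, e2)) => //=; apply/eqP => /(kinj _ _ l1 l2); exact: n12.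
  by rewrite pE mulfK // mulf_neq0 // subr_eq0 ?gt_eqF.
exists k'; split.
- by move=> e'; rewrite /k'; case: ifP.
- have fresh e' : e' \in l -> c <> k e'.
    by move=> l' cE; case/negP: ck; rewrite cE; exact: map_f.
  move=> e1 e2; rewrite !inE => /orP[/eqP ->|l1] /orP[/eqP ->|l2] //.
  + by rewrite k'e k'l // => /(fresh _ l2).
  + by rewrite k'e k'l // => /esym/(fresh _ l1).
  + by rewrite !k'l //; exact: kinj.
- move=> e1 e2 e3 p; rewrite !inE.
  move=> /orP[/eqP ->|l1] /orP[/eqP ->|l2] /orP[/eqP ->|l3] // n12 n13 n23 o1 o2 o3.
  + exact: new l2 l3 n23 o2 o3 o1.
  + exact: new l1 l3 n13 o1 o3 o2.
  + exact: new l1 l2 n12 o1 o2 o3.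
  + by apply: (ktriple e1 e2 e3 p) => //; rewrite -k'l.
Qed.

(* Without a drawing, [crossing_number] would be the default value of [xget]. *)
Lemma ex_drawing (R : realType) (G : mgraph) : exists n, drawable_with R G n.
Proof.
(* Vertices lie on the horizontal axis at their ranks, and edges are parabolic arcs above it, which
   therefore avoid the vertices. *)
pose rk (u : vertex G) : R := (enum_rank u)%:R.
have rk_inj : injective rk.
  by move=> u w /eqP; rewrite eqr_nat => /eqP/ord_inj/enum_rank_inj.
have sides e : exists uw : vertex G * vertex G,
    ends e = [set uw.1; uw.2]%SET /\ rk uw.1 < rk uw.2.
  have [u [w [uw ee]]] : exists u w, u != w /\ ends e = [set u; w]%SET.
    by apply/cards2P; rewrite card_ends.
  have [h|h|/rk_inj h] := ltgtP (rk u) (rk w).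
  - by exists (u, w).
  - by exists (w, u); rewrite finset.setUC.
  - by rewrite h eqxx in uw.
have [uw uwP] := choice sides.
pose a e := rk (uw e).1; pose b e := rk (uw e).2.
have ab e : a e < b e by have [] := uwP e.
have [k [k0 kinj ktriple]] := @generic_parabolas R _ a b (enum (edge G)).
pose arc e (t : R) := (a e + (b e - a e) * t,
  k e * (((b e - a e) * t) * (b e - (a e + (b e - a e) * t)))).
have inner_on e p : inner arc e p -> on_parabola (a e) (b e) (k e) p.
  move=> [t /andP[t0 t1] <-]; split; rewrite /arc /=;
    last by rewrite [a e + _]addrC addrK.
  have d0 : 0 < b e - a e by rewrite subr_gt0.
  rewrite ltrDl mulr_gt0 //= -ltrBrDl -[ltRHS]mulr1 ltr_pM2l //.
have meet (ee : edge G * edge G) : exists s : seq (R * R), ee.1 <> ee.2 -> forall p,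
    inner arc ee.1 p -> inner arc ee.2 p -> p \in s.
  have [h|h] := eqVneq ee.1 ee.2; first by exists [::].
  have kk : k ee.1 != k ee.2.
    by apply: contra_neq h; apply: kinj; rewrite mem_enum.
  have [s sP] := @parabolas_meet R (a ee.1) (b ee.1) _ (a ee.2) (b ee.2) _ kk.
  by exists s => _ p /inner_on h1 /inner_on h2; exact: sP.
have [S SP] := choice meet.
have [||n dn _] := @curve_system_drawable R G (fun u => (rk u, 0)) arc
  (flatten [seq S (e1, e2) | e1 <- enum (edge G), e2 <- enum (edge G)]);
  [| |by exists n]; last first.
- move=> e; exists (uw e).1, (uw e).2; have [-> _] := uwP e.
  split => //; rewrite /arc.
    by rewrite !mulr0 addr0 mul0r mulr0.
  by rewrite !mulr1 [a e + _]addrC subrK subrr !mulr0.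
split.
- by move=> u w [/rk_inj].
- move=> e; apply: continuous_subspaceT => t.
  have cx : (fun t : R => (b e - a e) * t) x @[x --> t] --> (b e - a e) * t.
    by apply: cvgM; [exact: cvg_cst|exact: cvg_id].
  have cs (c : R) : (fun=> c) x @[x --> t] --> c by exact: cvg_cst.
  exact: cvg_pair (cvgD (cs (a e)) cx)
    (cvgM (cs (k e)) (cvgM cx (cvgB (cs (b e)) (cvgD (cs (a e)) cx)))).
- move=> e t t' _ _ [/addrI/mulfI h _]; apply: h.
  by rewrite subr_eq0 gt_eqF.
- move=> e u /inner_on[/= /andP[h1 h2]] /eqP; rewrite eq_sym.
  by rewrite mulf_eq0 (gt_eqF (k0 e)) mulf_eq0 !subr_eq0 (gt_eqF h1) (gt_eqF h2).
- move=> e1 e2 e3 p n12 n13 n23 /inner_on o1 /inner_on o2 /inner_on o3.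
  by apply: (ktriple e1 e2 e3 p) => //; rewrite mem_enum.
- move=> e e' p ee' i i'; apply/flattenP; exists (S (e, e')).
    by apply/allpairsP; exists (e, e'); rewrite !mem_enum.
  exact: (SP (e, e')) ee' _ i i'.
Qed.

Lemma crossing_number_attained (R : realType) (G : mgraph) :
  drawable_with R G (crossing_number R G).
Proof. by have [n /crossing_number_drawable] := ex_drawing R G. Qed.

(** * Optimal drawings with prescribed ends *)

Lemma halfplane_any_order (R : realType) (G : mgraph) (v : vertex G) :
  simple_vertex v -> (degree v <> 3%N -> homogeneous_nbhd v) ->
  forall g : edge G -> R, {in [pred e | v \in ends e] &, injective g} ->
  halfplane (@ends G) v (crossing_number R G) g.
Proof.
move=> simple hom g ginj.
have [x hx] := halfplane_of_drawing v (crossing_number_attained R G).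
have [d3|/eqP d3] := eqVneq (degree v) 3%N; first exact: halfplane_three hx.
exact: (halfplane_homogeneous simple (hom d3) ginj hx).
Qed.

(** * Deleting an edge of a zip product *)

(** Lets the two factors be exchanged; the last clause records that edges of the second factor
    become edges of the first. *)
Lemma zip_product_sym (G1 G2 : mgraph) (v1 : vertex G1) (v2 : vertex G2)
    (sigma : {u | u \in nbhd v1} -> {w | w \in nbhd v2})
    (tau : {w | w \in nbhd v2} -> {u | u \in nbhd v1}) :
  cancel sigma tau -> cancel tau sigma ->
  exists (F : vertex (zip_product sigma) -> vertex (zip_product tau))
    (H : edge (zip_product sigma) -> edge (zip_product tau)),
    [/\ bijective F, bijective H, forall e, ends (H e) = F @: ends e &
      forall b, H (inl (inr b)) = inl (inl b)].
Proof.
move=> st ts.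
exists (fun u => match u with inl a => inr a | inr b => inl b end).
exists (fun e => match e with
  | inl (inl a) => inl (inr a) | inl (inr b) => inl (inl b)
  | inr u => inr (sigma u) end); split => //.
- by exists (fun u => match u with inl a => inr a | inr b => inl b end); case.
- exists (fun e => match e with
    | inl (inl a) => inl (inr a) | inl (inr b) => inl (inl b)
    | inr u => inr (tau u) end); first by case=> [[]|u] //=; rewrite st.
  by case=> [[]|u] //=; rewrite ts.
- case=> [[a|b]|u] /=.
  + by rewrite -imset_comp.
  + by rewrite -imset_comp.
  + by rewrite st imsetU1 imset_set1 finset.setUC.
Qed.

Lemma link_edge (G : mgraph) (v : vertex G) (u : {u | u \in nbhd v}) :
  exists e : edge G, ends e = [set val u; v]%SET.
Proof.
by have := valP u; rewrite inE => /existsP[e /eqP ee]; exists e.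
Qed.

Lemma del_vertex_ends_pair (G : mgraph) (v : vertex G)
    (e : edge (del_vertex v)) (u w : vertex (del_vertex v)) :
  ends (val e) = [set val u; val w]%SET -> ends e = [set u; w]%SET.
Proof.
move=> ee; apply/setP => x; rewrite !inE -!val_eqE.
by rewrite ee !inE.
Qed.

(** A drawing of [G1] minus the edge [e1] underlying [e0], with fewer than [k1] crossings, is glued
    to an optimal drawing of [G2] whose ends are placed to match. *)
Lemma zip_del_edge (R : realType) (G1 G2 G : mgraph) (k1 : nat)
    (v1 : vertex G1) (v2 : vertex G2)
    (sigma : {u | u \in nbhd v1} -> {w | w \in nbhd v2})
    (f : vertex G -> vertex (zip_product sigma))
    (g : edge G -> edge (zip_product sigma)) (e0 : edge G) :
  bijective sigma -> bijective f -> bijective g ->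
  (forall e, ends (g e) = f @: ends e) ->
  simple_vertex v2 -> (degree v2 <> 3%N -> homogeneous_nbhd v2) ->
  (forall e : edge G1, crossing_number R (del_edge e) < k1)%N ->
  (forall e2, g e0 <> inl (inr e2)) ->
  (crossing_number R (del_edge e0) < crossing_number R G2 + k1)%N.
Proof.
move=> [tau st ts] [f' ff' f'f] /bij_inj ginj gf simple hom crit ge0.
have [l1 l1P] := choice (@link_edge G1 v1).
have [l2 l2P] := choice (@link_edge G2 v2).
have v1l1 u : v1 \in ends (l1 u) by rewrite l1P !inE eqxx orbT.
have v2l2 u : v2 \in ends (l2 u) by rewrite l2P !inE eqxx orbT.
have l1inj : injective l1.
  move=> u u' h; apply/val_inj/(pair_inj (nbhd_neq (valP u))).
  by rewrite -l1P h l1P.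
have l2inj : injective l2.
  move=> u u' h; apply/val_inj/(pair_inj (nbhd_neq (valP u))).
  by rewrite -l2P h l2P.
(* The edges of [G1] and [G2] whose curves make up the edge [y]; a linking edge uses one of each. *)
pose p1 (y : edge (zip_product sigma)) : option (edge G1) := match y with
  | inl (inl a) => Some (val a) | inl (inr b) => None
  | inr u => Some (l1 u) end.
pose p2 (y : edge (zip_product sigma)) : option (edge G2) := match y with
  | inl (inl a) => None | inl (inr b) => Some (val b)
  | inr u => Some (l2 (sigma u)) end.
have p1inj y y' a : p1 y = Some a -> p1 y' = Some a -> y = y'.
  case: y => [[y|//]|y] /=; case: y' => [[y'|//]|y'] //= [ya] [y'a].
  - by congr (inl (inl _)); apply: val_inj; rewrite /= ya y'a.
  - by have := valP y; rewrite /= ya -y'a v1l1.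
  - by have := valP y'; rewrite /= y'a -ya v1l1.
  - by congr inr; apply: l1inj; rewrite ya y'a.
have p2inj y y' b : p2 y = Some b -> p2 y' = Some b -> y = y'.
  case: y => [[//|y]|y] /=; case: y' => [[//|y']|y'] //= [ya] [y'a].
  - by congr (inl (inr _)); apply: val_inj; rewrite /= ya y'a.
  - by have := valP y; rewrite /= ya -y'a v2l2.
  - by have := valP y'; rewrite /= y'a -ya v2l2.
  - by congr inr; apply: (can_inj st); apply: l2inj; rewrite ya y'a.
have [e1 e1P] : exists e1, p1 (g e0) = Some e1.
  case ge: (g e0) => [[a|b]|u] /=; [by exists (val a)| |by exists (l1 u)].
  by case: (ge0 b).
have [x1 hx1] := halfplane_of_drawing (v1 : vertex (del_edge e1))
  (crossing_number_attained R (del_edge e1)).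
(* If [e1] is a link, it has no end in the drawing of [G1 - e1]; the edge of [G2]
   matched with it then ends at the spare point [M]. *)
have [M _ Mx1] := fresh_pos [seq x1 a | a <- enum (edge (del_edge e1))].
pose X u := if insub (l1 u) is Some a then x1 a else M.
have Xinj : injective X.
  have nM a : x1 a <> M by move=> xM; case/negP: Mx1; rewrite -xM map_f ?mem_enum.
  move=> u u'; rewrite /X.
  case: insubP => [a _ ua|uN]; case: insubP => [a' _ ua'|uN'] => //.
  - move=> /(halfplane_inj hx1); rewrite /= ua ua' => /(_ (v1l1 u) (v1l1 u')) aa.
    by apply: l1inj; rewrite -ua -ua' aa.
  - by move=> h; case: (nM a).
  - by move=> h; case: (nM a').
  - move: uN uN'; rewrite !negbK => /eqP ue /eqP ue' _.
    by apply: l1inj; rewrite ue ue'.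
(* The positions of the links are transported to [G2]; by [link2] below, only edges avoiding [v2]
   get the value [0]. *)
pose x2 b := if [pick u | l2 (sigma u) == b] is Some u then X u else 0.
have x2E u : x2 (l2 (sigma u)) = X u.
  rewrite /x2; case: pickP => [u' /eqP/l2inj/(can_inj st) -> //|/(_ u)].
  by rewrite eqxx.
have link2 b : v2 \in ends b -> exists u, b = l2 (sigma u).
  move=> vb; have [w wN ew] := nbhd_edge vb.
  exists (tau (Sub w wN)); rewrite ts; apply: (simple _ _ vb).
  by rewrite l2P.
have hx2 : halfplane (@ends G2) v2 (crossing_number R G2) x2.
  apply: halfplane_any_order => // b b'; rewrite !inE.
  by move=> /link2[u ->] /link2[u' ->]; rewrite !x2E => /Xinj ->.
have Kends (e : edge (del_edge e0)) i' j' : ends (g (val e)) = [set i'; j']%SET ->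
    exists i j, [/\ ends e = [set i; j]%SET, f i = i' & f j = j'].
  move=> ge; exists (f' i'), (f' j'); rewrite !f'f; split => //.
  apply: (imset_inj (can_inj ff')).
  by rewrite imsetU1 imset_set1 !f'f -ge gf.
(* Distinct edges of the product use distinct edges of [G1], so every curve required is present in
   the drawing of [G1 - e1]. *)
have keep (e : edge (del_edge e0)) a : p1 (g (val e)) = Some a -> a != e1.
  move=> ea; apply/eqP => ae; have /eqP := valP e; apply.
  by apply: ginj; apply: (p1inj _ _ a) => //; rewrite ae.
have [] := @glue_halfplanes R _ _ _ _ (@ends (del_edge e1)) (@ends G2) v1 v2
  _ _ x1 x2 (del_edge e0) f (fun e a => p1 (g (val e)) = Some (val a))
  (fun e b => p2 (g (val e)) = Some b) (can_inj ff') _ _ _ hx1 hx2.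
- move=> e e' a h h'; apply/val_inj/ginj; exact: p1inj h h'.
- move=> e e' b h h'; apply/val_inj/ginj; exact: p2inj h h'.
- move=> e; case ge: (g (val e)) => [[y|y]|u].
  + have ke : val y != e1 by apply: (keep e); rewrite ge.
    apply: Or31; exists (Sub (val y) ke); split => //=; first exact: valP y.
    move=> u w ey; apply: Kends.
    by rewrite ge -[LHS]/(inl @: ends y) (del_vertex_ends_pair ey) imsetU1 imset_set1.
  + apply: Or32; exists (val y); split => //; first exact: valP y.
    move=> u w ey; apply: Kends.
    by rewrite ge -[LHS]/(inr @: ends y) (del_vertex_ends_pair ey) imsetU1 imset_set1.
  + have ke : l1 u != e1 by apply: (keep e); rewrite ge.
    apply: Or33; exists (Sub (l1 u) ke), (l2 (sigma u)); split => //=.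
    * by rewrite x2E /X (insubT (fun e' => e' != e1) ke).
    * rewrite l1P l2P => w w' h h'; apply: Kends; rewrite ge /=.
      have -> : nbr_del u = w.
        by apply: val_inj; apply: (pair_inj (nbhd_neq (valP u)) h).
      have -> // : nbr_del (sigma u) = w'.
      by apply: val_inj; apply: (pair_inj (nbhd_neq (valP (sigma u))) h').
move=> n dn; rewrite addnC => nle.
apply: leq_ltn_trans (crossing_number_le dn) _; apply: leq_ltn_trans nle _.
by rewrite ltn_add2l; exact: crit.
Qed.

Local Close Scope classical_set_scope.
Local Close Scope ring_scope.

Theorem theorem21 (R : realType) (G1 G2 G : mgraph) (k1 k2 d : nat)
    (v1 : vertex G1) (v2 : vertex G2)
    (nodeg2_1 : no_degree_two G1) (nodeg2_2 : no_degree_two G2)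
    (crit1 : crossing_critical R k1 G1) (crit2 : crossing_critical R k2 G2)
    (simple1 : simple_vertex v1) (simple2 : simple_vertex v2)
    (deg1 : degree v1 = d) (deg2 : degree v2 = d)
    (hom : d <> 3 -> homogeneous_nbhd v1 /\ homogeneous_nbhd v2)
    (zipG : in_zip_products v1 v2 G) :
  let k := maxn (crossing_number R G1 + k2)%N (crossing_number R G2 + k1)%N in
  (k <= crossing_number R G)%N -> crossing_critical R k G.
Proof.
(* It suffices to stay below one of the two terms of the maximum; which one depends on the origin of
   [e0]. *)
move=> k kG; split => // e0; rewrite /k leq_max.
have hom1 : degree v1 <> 3 -> homogeneous_nbhd v1 by rewrite deg1 => /hom[].
have hom2 : degree v2 <> 3%N -> homogeneous_nbhd v2 by rewrite deg2 => /hom[].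
have [sigma sbij [f [g [fbij gbij gf]]]] := zipG.
have [[b gb]|gn] : (exists b, g e0 = inl (inr b)) \/
    forall b, g e0 <> inl (inr b).
  by case: (g e0) => [[a|b]|u]; [right|left; exists b|right].
(* For an edge of [G2 - v2] the factors are exchanged, and the criticality of [G2] is used. *)
- have [tau st ts] := sbij.
  have [F [H [Fbij Hbij HF Hinr]]] := zip_product_sym st ts.
  apply/orP; left; rewrite /crossing_critical in crit2.
  apply: (@zip_del_edge R G2 G1 G k2 v2 v1 tau (F \o f) (H \o g)) => //.
  + by exists sigma.
  + exact: bij_comp.
  + exact: bij_comp.
  + by move=> e; rewrite imset_comp -gf -HF.
  + exact: crit2.2.
  + by move=> a; rewrite /= gb Hinr.
- apply/orP; right.
  by apply: (zip_del_edge sbij fbij gbij gf simple2 hom2 _ gn); exact: crit1.2.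
Qed.
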